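(* Let $K$ be a global function field of characteristic $p$, and let $F/K$ be a finite abelian extension of degree $p^m$. Let $S$ be a finite set of places of $F$. Suppose given for each $v\in S$ a $p$-primary extension $E^v/F_v$ of degree $\le p^n$ such that $E^v$ is abelian over $K_w$, where $w$ is the place of $K$ below $v$. Then there is a $p$-primary extension $E/F$, with $E/K$ abelian, such that for each place $v'$ of $E$ lying above a place $v\in S$, $E_{v'}$ and $E^v$ are $F_v$-isomorphic, and such that (i) $[E:F]\le p^{(n+m)(1+\log(n+m))}$; (ii) if $m=0$ (so $F=K$) and $H$ is a finite abelian group such that for each $v\in S$ there is an injective homomorphism $\mathrm{Gal}(E^v/K_w)\hookrightarrow H$, then there is an injective homomorphism $\mathrm{Gal}(E/K)\hookrightarrow H$.
   Context: An extension is $p$-primary if every finite subextension has $p$-power degree. $\log$ is the natural logarithm, with the convention $0\log 0=0$.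
   Formalization: Added hypothesis: if two places v1, v2 of S lie above the same place w of K, then E^{v1} and E^{v2} are K_w-isomorphic; without it the claim fails (w split in F, local degrees 1 and p), and the conclusion forces it because E/K is Galois. *)

(* Defs.v *)
From HB Require Import structures.
From mathcomp Require Import all_boot all_order all_algebra all_fingroup all_field.
From mathcomp Require Import fraction.
From mathcomp Require Import boolp classical_sets cardinality reals exp.

Set Implicit Arguments.
Unset Strict Implicit.
Unset Printing Implicit Defensive.

Import Order.TTheory GRing.Theory Num.Theory.
Local Open Scope ring_scope.

Definition global_function_field (p : nat) (K : fieldType) : Prop :=
  exists (k : finFieldType) (L : fieldExtType {fraction {poly k}})
         (f : {rmorphism L -> K}),
    p \in [pchar k] /\ bijective f.

(* A place is represented by its normalized discrete valuation (every place of
   a global function field is discrete).  The value at 0, morally +oo, is fixed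
   to the dummy value 0, so that Leibniz equality is equality of places; the
   axioms and the uses below keep 0 apart.                                     *)
Record place (K : fieldType) : Type := Place {
  pval :> K -> int;
  pval0 : pval 0 = 0;
  pvalM : forall x y, x != 0 -> y != 0 -> pval (x * y) = pval x + pval y;
  pvalD : forall x y, x != 0 -> y != 0 -> x + y != 0 ->
            Num.min (pval x) (pval y) <= pval (x + y);
  pval_normalized : exists x, pval x = 1
}.

(* "v lies above w", the integer e being the ramification index. *)
Definition lies_above (K L : fieldType) (i : {rmorphism K -> L})
    (w : place K) (v : place L) : Prop :=
  exists e : nat, (0 < e)%N /\ forall x, v (i x) = w x *+ e.

Definition vclose (K : fieldType) (v : place K) (N : int) (x y : K) : bool :=
  (x == y) || (N <= v (x - y)).

Definition vcauchy (K : fieldType) (v : place K) (u : nat -> K) : Prop :=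
  forall N : int, exists n0 : nat, forall i j : nat,
    (n0 <= i)%N -> (n0 <= j)%N -> vclose v N (u i) (u j).

Definition vconverges (K : fieldType) (v : place K) (u : nat -> K) (l : K) : Prop :=
  forall N : int, exists n0 : nat, forall i : nat, (n0 <= i)%N -> vclose v N (u i) l.

Definition is_completion (K : fieldType) (v : place K) (C : fieldType)
    (emb : {rmorphism K -> C}) (vC : place C) : Prop :=
  [/\ forall x, vC (emb x) = v x,
      forall u : nat -> C, vcauchy vC u -> exists l, vconverges vC u l
    & forall (y : C) (N : int), exists x : K, vclose vC N (emb x) y].

(* Completions are unique up to a unique isomorphism; statements are quantified
   over all of them. *)
Record completion (K : fieldType) (v : place K) : Type := Completion {
  cpl_field :> fieldType;
  cpl_emb : {rmorphism K -> cpl_field};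
  cpl_val : place cpl_field;
  cpl_isP : is_completion v cpl_emb cpl_val
}.

(* c is the canonical (continuous) extension to completions of i : K -> L. *)
Definition is_canonical_map (K L : fieldType) (i : {rmorphism K -> L})
    (w : place K) (v : place L) (Kw : completion w) (Lv : completion v)
    (c : {rmorphism Kw -> Lv}) : Prop :=
  (forall x : K, c (cpl_emb Kw x) = cpl_emb Lv (i x)) /\
  lies_above c (cpl_val Kw) (cpl_val Lv).

(* A completion F_v of F at a place v above w, with its K_w-algebra structure
   given by the canonical map K_w -> F_v. *)
Record completion_over (K : fieldType) (F : fieldExtType K)
    (w : place K) (Kw : completion w) (v : place F) : Type := CompletionOver {
  cplo_field :> fieldExtType Kw;
  cplo_emb : {rmorphism F -> cplo_field};
  cplo_val : place cplo_field;
  cplo_isP : is_completion v cplo_emb cplo_val;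
  cplo_canonical :
    is_canonical_map (in_alg F) (Lv := Completion cplo_isP) (in_alg cplo_field)
}.

Definition cplo_completion (K : fieldType) (F : fieldExtType K)
    (w : place K) (Kw : completion w) (v : place F) (Fv : completion_over Kw v) :
  completion v := Completion (cplo_isP Fv).

Definition p_primary (p : nat) (F E : fieldType) (i : {rmorphism F -> E}) : Prop :=
  forall (L : fieldExtType F) (j : {rmorphism L -> E}),
    (forall a : F, j a%:A = i a) -> exists k : nat, \dim {:L} = (p ^ k)%N.

Definition abelian_extension (K : fieldType) (L : splittingFieldType K) : Prop :=
  galois 1 {:L} /\ abelian 'Gal({:L} / 1).

Definition ext_degree (K : fieldType) (F E : fieldExtType K)
    (i : {lrmorphism F -> E}) : nat :=
  \dim_(limg (linfun i)) {:E}.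

Definition group_embeds (gT hT : finGroupType) (G : {group gT}) (H : {group hT}) : Prop :=
  exists f : {morphism G >-> hT}, ('injm f /\ f @* G \subset H)%g.

(* Main.v *)
(** For a field R of characteristic p and N = p^a, the units of R[t]/(t^N)
    congruent to 1 mod t form the points of a connected unipotent group U, and
    Lang's equation [phi b = A b], with [phi] the coefficientwise Frobenius,
    is a tower of Artin-Schreier equations whose solutions form a torsor under
    the finite group U(F_p).  The unit 1 + t has order p^a, the exponent of U(F_p), so U(F_p) retracts onto
    <1 + t> = Z/p^a: this replaces Witt vectors in the description of
    Z/p^a-extensions.

    Local step: an averaging argument (additive Hilbert 90) realizes every
    character of Gal(E^v/K_w) with values in <1 + t> by a solution b over E^v,
    with A over K_w; by completeness a slight change of A does not change the
    extension.  Global step: weak approximation chooses the coefficients of A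
    in K for all places at once.  Galois theory then produces E as the subfield
    fixed by the automorphisms that fix F and have trivial characters; its
    compositum with K_w is E^v, and is also the completion of E because finite
    dimensional subspaces over a complete field are closed.

    The characters used have orders p^(a_k), with a_k the largest k-th
    invariant of the local Galois groups (abelian p-groups of order at most
    p^(n+m)).  Hence (k+1) a_k <= n+m and the degree is bounded by a harmonic
    sum; for m = 0 the joint kernel of the characters is trivial, and the
    inequalities between invariants give the embedding into H. *)

Require Import Defs.
From HB Require Import structures.
From mathcomp Require Import all_boot all_order all_algebra all_fingroup all_field.
From mathcomp Require Import all_solvable.
From mathcomp Require Import fraction.
From mathcomp Require Import boolp classical_sets cardinality reals exp.
From mathcomp Require Import zify ring.

Set Implicit Arguments.
Unset Strict Implicit.
Unset Printing Implicit Defensive.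

Import Order.TTheory GRing.Theory Num.Theory.
Local Open Scope ring_scope.

(** * Valuations and completions *)

(** The local solution has the exact cocycle [(1 + 'X) ^+ chi s], whereas a global solution only has
    some cocycle with values in U(F_p). The retraction makes the two comparable: it turns the global
    cocycle into a character, and it reads [chi] off any cocycle of the local shape. The comparison
    takes place in a field M that contains both E^v and an image of the global field of solutions.
    Two solutions of one equation differ there by a factor with coefficients in F_p, which no
    automorphism moves, so their cocycles agree.

    Characters of Gal(E^v/K_w) are used rather than of Gal(E^v/F_v), so that the equations live over
    K. Then E/K is abelian, because a commutator fixes F and has trivial characters. Weak
    approximation asks for distinct places of K, so one v is kept above each w, and the other places
    of S are reached through the compatibility isomorphisms.

    Characters are encoded as functions to natural numbers, additive modulo p^a. *)

Section Valuation.
Variables (K : fieldType) (v : place K).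
Implicit Types (x y z : K) (N M : int).

Lemma pval1 : v 1 = 0.
Proof. by apply: (addrI (v 1)); rewrite addr0 -pvalM ?mulr1 ?oner_neq0. Qed.

Lemma pvalV x : v x^-1 = - v x.
Proof.
have [->|x0] := eqVneq x 0; first by rewrite invr0 pval0.
by apply: (addrI (v x)); rewrite subrr -pvalM ?invr_eq0 // mulfV // pval1.
Qed.

Lemma pvalN1 : v (- 1) = 0.
Proof.
have n0 : - 1 != 0 :> K by rewrite oppr_eq0 oner_neq0.
have h : v (-1) + v (-1) = 0 by rewrite -pvalM // mulrNN mulr1 pval1.
by lia.
Qed.

Lemma pvalN x : v (- x) = v x.
Proof.
have [->|x0] := eqVneq x 0; first by rewrite oppr0.
by rewrite -mulN1r pvalM ?pvalN1 ?add0r ?oppr_eq0 ?oner_neq0.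
Qed.

Lemma pvalX x k : v (x ^+ k) = v x *+ k.
Proof.
have [->|x0] := eqVneq x 0; first by rewrite expr0n; case: k => [|k] /=; rewrite ?pval1 ?pval0 ?mulr0n // mul0rn.
by elim: k => [|k IH]; rewrite ?expr0 ?pval1 ?mulr0n // exprS pvalM ?expf_neq0 // IH mulrS.
Qed.

Lemma pval_neq0 x : v x != 0 -> x != 0.
Proof. by apply: contra_neq => ->; rewrite pval0. Qed.

Definition vge N x : bool := (x == 0) || (N <= v x).

Lemma vcloseE N x y : vclose v N x y = vge N (x - y).
Proof. by rewrite /vclose /vge subr_eq0. Qed.

Lemma vge0 N : vge N 0. Proof. by rewrite /vge eqxx. Qed.

Lemma vgeN N x : vge N (- x) = vge N x.
Proof. by rewrite /vge oppr_eq0 pvalN. Qed.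

Lemma vgeD N x y : vge N x -> vge N y -> vge N (x + y).
Proof.
rewrite /vge; have [->|x0] := eqVneq x 0; first by rewrite add0r.
have [->|y0] := eqVneq y 0; first by rewrite addr0 (negPf x0).
have [//|s0] := eqVneq (x + y) 0; move=> /= hx hy.
by apply: le_trans (pvalD v x0 y0 s0); rewrite le_min hx hy.
Qed.

Lemma vgeB N x y : vge N x -> vge N y -> vge N (x - y).
Proof. by move=> hx hy; apply: vgeD; rewrite ?vgeN. Qed.

Lemma vge_sum N (I : Type) (r : seq I) (P : pred I) (f : I -> K) :
  (forall i, P i -> vge N (f i)) -> vge N (\sum_(i <- r | P i) f i).
Proof. by move=> h; elim/big_rec: _ => [|i x Pi hx]; [exact: vge0 | apply: vgeD => //; exact: h]. Qed.

Lemma vgeM N M x y : vge N x -> vge M y -> vge (N + M) (x * y).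
Proof.
rewrite /vge mulf_eq0; have [//|x0] := eqVneq x 0; have [//|y0] := eqVneq y 0.
by move=> /= hx hy; rewrite pvalM // lerD.
Qed.

Lemma vge_le N M x : M <= N -> vge N x -> vge M x.
Proof. by move=> h /orP[/eqP->|h2]; rewrite /vge ?eqxx // (le_trans h h2) orbT. Qed.

Lemma vgeC N x y : vge N (x - y) = vge N (y - x).
Proof. by rewrite -vgeN opprB. Qed.

Lemma vge_trans N x y z : vge N (x - y) -> vge N (y - z) -> vge N (x - z).
Proof. by move=> h1 h2; rewrite -(subrKA y); apply: vgeD. Qed.

Lemma vge_val x : vge (v x) x. Proof. by rewrite /vge lexx orbT. Qed.

Lemma vge_eq0 x : (forall N, vge N x) -> x = 0.
Proof. by move=> h; have := h (v x + 1); rewrite /vge => /orP[/eqP//|]; lia. Qed.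

Lemma pval_close x y N : x != 0 -> v x < N -> vge N (y - x) -> v y = v x.
Proof.
move=> x0 xN /orP[|h]; first by rewrite subr_eq0 => /eqP->.
have [d0|d0] := eqVneq (y - x) 0; first by move/eqP: d0; rewrite subr_eq0 => /eqP->.
have y0 : y != 0.
  by apply/eqP => yE; move: h; rewrite yE sub0r pvalN; lia.
have n0 : - (y - x) != 0 by rewrite oppr_eq0.
have xE : y + - (y - x) = x by rewrite opprB addrC subrK.
have yE : x + (y - x) = y by rewrite addrC subrK.
have h1 := pvalD v y0 n0; rewrite xE pvalN in h1.
have h2 := pvalD v x0 d0; rewrite yE in h2.
move: (h1 x0) (h2 y0); lia.
Qed.

Lemma vlim_unique (u : nat -> K) l1 l2 :
  vconverges v u l1 -> vconverges v u l2 -> l1 = l2.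
Proof.
move=> h1 h2; apply/eqP; rewrite -subr_eq0; apply/eqP/vge_eq0 => N.
have [n1 {}h1] := h1 N; have [n2 {}h2] := h2 N.
have := h1 (maxn n1 n2) (leq_maxl _ _); have := h2 (maxn n1 n2) (leq_maxr _ _).
rewrite !vcloseE => a b; rewrite vgeC in b; exact: vge_trans b a.
Qed.

End Valuation.

(** * Weak approximation for finitely many places *)

Section WeakApproximation.
Variable K : fieldType.
Implicit Types (u v : place K).

Lemma place_eqP u v : (forall x, u x = v x) -> u = v.
Proof.
case: u v => [f f0 fM fD fn] [g g0 gM gD gn] /= h.
have E : f = g by apply/funext.
by subst g; f_equal; exact: Prop_irrelevance.
Qed.

(** Elements of [u]-value 0 have [v]-value 0, since the hypothesis applies to them and to their
    inverses. Hence [v] is [v t] times [u] for a uniformizer [t] of [u], and as [v] takes the value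
    1 this factor is 1. *)
Lemma place_subring_eq u v : (forall x, 0 <= u x -> 0 <= v x) -> u = v.
Proof.
move=> h; have [t ut] := pval_normalized u; have [s vs] := pval_normalized v.
have t0 : t != 0 by apply: (pval_neq0 (v := u)); rewrite ut.
have unit x : u x = 0 -> v x = 0.
  move=> ux; have := h x; have := h x^-1; rewrite !pvalV ux; lia.
pose pw (z : int) : K := if z is Posz k then t ^+ k else t ^- `|z|.
have pw0 z : pw z != 0 by case: z => k /=; rewrite ?invr_eq0 expf_neq0.
have upw z : u (pw z) = z.
  by case: z => k /=; rewrite ?pvalV pvalX ut; lia.
have vpw z : v (pw z) = v t * z.
  by case: z => k /=; rewrite ?pvalV pvalX; lia.
have E x : x != 0 -> v x = v t * u x.
  move=> x0; have q0 : x / pw (u x) != 0 by rewrite mulf_neq0 ?invr_eq0.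
  have := unit (x / pw (u x)); rewrite !pvalM ?invr_eq0 // !pvalV upw subrr vpw.
  by move=> /(_ erefl); lia.
have s0 : s != 0 by apply: (pval_neq0 (v := v)); rewrite vs.
have := E s s0; rewrite vs => Es; have vt0 : 0 <= v t by apply: h; rewrite ut.
have vt1 : v t = 1.
  have [lt1|gt1|//] := ltgtP (v t) 1.
    by have vt : v t = 0 by [lia]; rewrite vt mul0r in Es.
  by have [us|us] := lerP (u s) 0; nia.
apply: place_eqP => x; have [->|x0] := eqVneq x 0; first by rewrite !pval0.
by rewrite E // vt1 mul1r.
Qed.

(** Neither valuation ring contains the other; the quotient of the two witnesses has the required
    signs. *)
Lemma place_separate u v : u <> v -> exists x, u x < 0 /\ 0 < v x.
Proof.
have half u' v' : u' <> v' -> exists x, 0 <= u' x /\ v' x < 0.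
  move=> neq; apply: contrapT => H; apply: neq; apply: place_subring_eq => x ux.
  by rewrite leNgt; apply/negP => vx; apply: H; exists x.
move=> neq; have [x [ux vx]] := half _ _ neq.
have [y [vy uy]] := half v u (fun e => neq (esym e)).
have x0 : x != 0 by apply: (pval_neq0 (v := v)); lia.
have y0 : y != 0 by apply: (pval_neq0 (v := u)); lia.
by exists (y / x); rewrite !pvalM ?invr_eq0 // !pvalV; lia.
Qed.

Lemma one_plus_exp_neq0 u x k : u x < 0 -> (0 < k)%N -> 1 + x ^+ k != 0.
Proof.
move=> ux k0; apply/eqP => /eqP; rewrite addrC addr_eq0 => /eqP /(congr1 u).
rewrite pvalX pvalN1; nia.
Qed.

Lemma pval_one_plus_neg u x k : u x < 0 -> (0 < k)%N -> u (1 + x ^+ k) = u x *+ k.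
Proof.
move=> ux k0; rewrite -pvalX; apply: (@pval_close _ _ _ _ 0).
- by rewrite expf_neq0 // (pval_neq0 (v := u)) //; lia.
- by rewrite pvalX; nia.
- by rewrite addrK /vge pval1 lexx orbT.
Qed.

Lemma pval_one_plus_pos u x k : 0 < u x -> (0 < k)%N -> u (1 + x ^+ k) = 0.
Proof.
move=> ux k0; rewrite -(pval1 u); apply: (@pval_close _ _ _ _ 1); rewrite ?oner_neq0 ?pval1 //.
by rewrite addrC addKr /vge pvalX; apply/orP; right; nia.
Qed.

Lemma place_separate_all u (vs : seq (place K)) :
  (forall v, List.In v vs -> u <> v) ->
  exists x, u x < 0 /\ forall v, List.In v vs -> 0 < v x.
Proof.
elim: vs => [|v vs IH] neq.
  have [t ut] := pval_normalized u; exists t^-1; rewrite pvalV ut; split=> //.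
have [|y [uy vy]] := IH; first by move=> v' h; apply: neq; right.
have [z [uz vz]] := place_separate (neq v (or_introl erefl)).
have y0 : y != 0 by apply: (pval_neq0 (v := u)); lia.
have z0 : z != 0 by apply: (pval_neq0 (v := u)); lia.
have [k [k0 kP]] : exists k : nat, (0 < k)%N /\ forall v, List.In v vs -> 0 < v y *+ k + v z.
  elim: vs vy {IH neq} => [|w vs IH] vy; first by exists 1%N.
  have [|k [k0 kP]] := IH; first by move=> v' h; apply: vy; right.
  exists (k + `|w z|.+1)%N; split; first by lia.
  move=> v' [<-|h]; last by have := kP v' h; have := vy v' (or_intror h); nia.
  by have := vy w (or_introl erefl); nia.
have yk0 : y ^+ k != 0 by rewrite expf_neq0.
have [vy0|vy0|vy0] := ltgtP (v y) 0.
(* Here [y] works for the places of [vs] and [z] separates [u] from [v]. If [v y < 0], the factor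
   [y ^+ k / (1 + y ^+ k)] has value 0 at [u] and [v] and is small at the other places, so it
   corrects [z] there. If [v y = 0], a high power of [y] does. *)
- exists (z * (y ^+ k / (1 + y ^+ k))).
  have d0 := one_plus_exp_neq0 uy k0.
  have E (w : place K) : w (z * (y ^+ k / (1 + y ^+ k))) = w z + (w y *+ k - w (1 + y ^+ k)).
    by rewrite !pvalM ?mulf_neq0 ?invr_eq0 // pvalX pvalV.
  rewrite E (pval_one_plus_neg uy k0); split; first by lia.
  move=> w [<-|h]; rewrite E; first by rewrite (pval_one_plus_neg vy0 k0); lia.
  by rewrite (pval_one_plus_pos (vy w h) k0); have := kP w h; lia.
- exists y; split=> // w [<-|h] //; exact: vy.
- exists (y ^+ k * z); split; first by rewrite pvalM // pvalX; nia.
  move=> w [<-|h]; rewrite pvalM // pvalX; first by rewrite vy0; lia.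
  by have := kP w h; lia.
Qed.

Lemma weak_approximation r (u : 'I_r -> place K) (x : 'I_r -> K) (M : 'I_r -> int) :
  injective u -> exists y, forall i, vge (u i) (M i) (y - x i).
Proof.
move=> uI.
have sep i : exists t, u i t < 0 /\ forall j, j != i -> 0 < u j t.
  have [|t [ut vt]] := @place_separate_all (u i) [seq u j | j <- enum 'I_r & j != i].
    move=> v; elim: (enum 'I_r) => //= j s IH; case: ifP => // ji /= [<-|//].
    by move=> /uI E; rewrite E eqxx in ji.
  exists t; split=> // j ji; apply: vt.
  have : j \in enum 'I_r by rewrite mem_enum.
  elim: (enum 'I_r) => //= k s IH; rewrite inE => /orP[/eqP<-|h].
    by rewrite ji; left.
  by case: ifP => _ //=; [right|]; exact: IH.
have [t tP] := choice sep.
pose B := \sum_(i < r) \sum_(j < r) (`|u i (x j)| + `|M i|)%N.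
have BP i j : `|M i| + `|u i (x j)| <= B%:Z.
  rewrite /B (bigD1 i) //= (bigD1 j) //=; lia.
(* [e i] is close to 1 at [u i] and to 0 at the other places; [k] exceeds every
   [|M i| + |u i (x j)|], so each error term at [u i] has value at least [M i]. *)
pose k := B.+1; pose e i := t i ^+ k / (1 + t i ^+ k).
have k0 : (0 < k)%N by [].
have t0 i : t i != 0 by apply: (pval_neq0 (v := u i)); have [h _] := tP i; lia.
have d0 i : 1 + t i ^+ k != 0 by apply: (one_plus_exp_neq0 (u := u i)) => //; have [] := tP i.
have e1 i : vge (u i) k (e i - 1).
  have -> : e i - 1 = - (1 + t i ^+ k)^-1.
    by apply: (mulIf (d0 i)); rewrite mulrBl divfK // mulNr mulVf //; ring.
  rewrite vgeN /vge pvalV pval_one_plus_neg //; last by have [] := tP i.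
  apply/orP; right; have [h _] := tP i; nia.
have e0 i j : j != i -> vge (u j) k (e i).
  move=> ji; rewrite /vge pvalM ?expf_neq0 ?invr_eq0 // pvalV pvalX.
  have [_ /(_ j ji) h] := tP i; rewrite pval_one_plus_pos //.
  by apply/orP; right; nia.
exists (\sum_i e i * x i) => i.
rewrite (bigD1 i) //= addrAC -{2}[x i]mul1r -mulrBl; apply: vgeD.
  apply: (@vge_le _ _ (k%:Z + u i (x i))); first by have := BP i i; lia.
  by apply: vgeM; rewrite ?e1 ?vge_val.
apply: vge_sum => j ji; apply: (@vge_le _ _ (k%:Z + u i (x j))).
  by have := BP i j; lia.
by apply: vgeM; rewrite ?vge_val // e0 // eq_sym.
Qed.

End WeakApproximation.

(** * Continuous extension of an embedding to the completion *)

Section CompletionMap.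
Variables (F : fieldType) (v : place F) (C : fieldType) (emb : {rmorphism F -> C})
  (vC : place C) (D : fieldType) (vD : place D) (i : {rmorphism F -> D}) (e : nat).
Hypotheses (Ccpl : is_completion v emb vC)
  (Dcomplete : forall u : nat -> D, vcauchy vD u -> exists l, vconverges vD u l)
  (e_gt0 : (0 < e)%N) (iP : forall x, vD (i x) = v x *+ e).

Let dense (y : C) (N : int) : exists x, vge vC N (emb x - y).
Proof. by have [_ _ /(_ y N)[x]] := Ccpl; rewrite vcloseE => h; exists x. Qed.

Let vemb x : vC (emb x) = v x. Proof. by have [] := Ccpl. Qed.

Let i_close (N : int) x : vge vC N (emb x) -> vge vD (N *+ e) (i x).
Proof.
rewrite /vge !fmorph_eq0 vemb iP => /orP[->//|h]; apply/orP; right.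
by rewrite lerMn2r h orbT.
Qed.

Let mulrn_ge (N : int) : N <= `|N| *+ e. Proof. by nia. Qed.

(** [l] is the limit of [i x] as [emb x] tends to [y]. Quantifying over all nearby [x], not over a
    sequence, lets algebraic identities be checked by approximation. *)
Let lim_ext (y : C) (l : D) :=
  forall N : int, exists M : int, forall x, vge vC M (emb x - y) -> vge vD N (i x - l).

Let lim_ext_unique y l1 l2 : lim_ext y l1 -> lim_ext y l2 -> l1 = l2.
Proof.
move=> h1 h2; apply/eqP; rewrite -subr_eq0; apply/eqP/(vge_eq0 (v := vD)) => N.
have [M1 {}h1] := h1 N; have [M2 {}h2] := h2 N.
have [x hx] := dense y (Num.max M1 M2).
have := h1 x; have := h2 x.
move=> /(_ (vge_le _ hx)); rewrite le_max lexx orbT => /(_ isT) a.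
move=> /(_ (vge_le _ hx)); rewrite le_max lexx => /(_ isT) b.
by rewrite vgeC in b; exact: vge_trans b a.
Qed.

Let lim_ext_exists y : exists l, lim_ext y l.
Proof.
have [x xP] := choice (fun n : nat => dense y n%:Z).
have [|l lP] := Dcomplete (u := fun n => i (x n)).
  move=> N; exists `|N|%N => a b ha hb; rewrite vcloseE -rmorphB.
  apply: vge_le (i_close (N := `|N|) _); first exact: mulrn_ge.
  rewrite rmorphB; apply: (vge_trans (y := y)); [|rewrite vgeC].
    by apply: vge_le (xP a); lia.
  by apply: vge_le (xP b); lia.
exists l => N; exists `|N| => z hz; have [n0 n0P] := lP N.
pose n := maxn n0 `|N|%N.
have := n0P n (leq_maxl _ _); rewrite vcloseE; apply: vge_trans; rewrite -rmorphB.
apply: vge_le (i_close (N := `|N|) _); first exact: mulrn_ge.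
rewrite rmorphB; apply: (vge_trans hz); rewrite vgeC.
by apply: vge_le (xP n); rewrite /n; lia.
Qed.

Lemma completion_map : exists c : {rmorphism C -> D},
  (forall x, c (emb x) = i x) /\ (forall y, vD (c y) = vC y *+ e).
Proof.
have [f fP] := choice lim_ext_exists.
have near_i (N : int) x : vge vC `|N| (emb x) -> vge vD N (i x).
  by move=> h; apply: vge_le (i_close h); exact: mulrn_ge.
have fE x : f (emb x) = i x.
  apply: (lim_ext_unique (fP _)) => N; exists `|N| => z hz.
  by rewrite -rmorphB; apply: near_i; rewrite rmorphB.
have fB : zmod_morphism f.
  move=> y z; apply: (lim_ext_unique (fP _)) => N.
  have [M1 h1] := fP y N; have [M2 h2] := fP z N.
  pose P := `|N| + `|M1| + `|M2|.
  have [a ha] := dense y P; have [b hb] := dense z P.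
  exists P => x hx.
  have -> : i x - (f y - f z) = i (x - (a - b)) + ((i a - f y) - (i b - f z)).
    by rewrite !rmorphB; ring.
  apply: vgeD; last apply: vgeB.
  - apply: near_i.
    have -> : emb (x - (a - b)) = (emb x - (y - z)) - ((emb a - y) - (emb b - z)).
      by rewrite !rmorphB; ring.
    apply: (@vge_le _ _ P); first by rewrite /P; lia.
    by apply: vgeB => //; exact: vgeB.
  - by apply: h1; apply: vge_le ha; rewrite /P; lia.
  - by apply: h2; apply: vge_le hb; rewrite /P; lia.
have fM y z : f (y * z) = f y * f z.
  apply: (lim_ext_unique (fP _)) => N.
  (* The precision is raised by the values of both limits because the error of a product has cross
     terms such as [(i a - f y) * f z]. *)
  pose N' := `|N| + `|vD (f y)| + `|vD (f z)|.
  have [M1 h1] := fP y N'; have [M2 h2] := fP z N'.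
  pose P := `|N| + `|M1| + `|M2| + `|vC y| + `|vC z|.
  have [a ha] := dense y P; have [b hb] := dense z P.
  exists P => x hx.
  have -> : i x - (f y * f z) = i (x - a * b) + ((i a - f y) * (i b - f z)
     + ((i a - f y) * f z + f y * (i b - f z))).
    by rewrite !rmorphB rmorphM; ring.
  have {}h1 : vge vD N' (i a - f y) by apply: h1; apply: vge_le ha; rewrite /P; lia.
  have {}h2 : vge vD N' (i b - f z) by apply: h2; apply: vge_le hb; rewrite /P; lia.
  apply: vgeD; last (apply: vgeD; last apply: vgeD).
  - apply: near_i.
    have -> : emb (x - a * b) = (emb x - y * z) - ((emb a - y) * (emb b - z)
       + ((emb a - y) * z + y * (emb b - z))).
      by rewrite !rmorphB rmorphM; ring.
    apply: vgeB; last (apply: vgeD; last apply: vgeD).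
    + by apply: vge_le hx; rewrite /P; lia.
    + by apply: vge_le (vgeM ha hb); rewrite /P; lia.
    + by apply: vge_le (vgeM ha (vge_val vC z)); rewrite /P; lia.
    + by apply: vge_le (vgeM (vge_val vC y) hb); rewrite /P; lia.
  - by apply: vge_le (vgeM h1 h2); rewrite /N'; lia.
  - by apply: vge_le (vgeM h1 (vge_val vD _)); rewrite /N'; lia.
  - by apply: vge_le (vgeM (vge_val vD _) h2); rewrite /N'; lia.
have f1 : f 1 = 1 by rewrite -(rmorph1 emb) fE rmorph1.
pose fA := GRing.isZmodMorphism.Build C D f fB.
pose fR := GRing.isMonoidMorphism.Build C D f (conj f1 fM).
pose c : {rmorphism C -> D} := HB.pack f fA fR.
exists c; split=> // y; change (vD (f y) = vC y *+ e).
have [->|y0] := eqVneq y 0.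
  by have -> : f 0 = 0 := rmorph0 c; rewrite !pval0 mul0rn.
(* A valuation is locally constant away from 0, so both sides can be computed at a nearby element of
   [F]. *)
have [M hM] := fP y (`|vC y *+ e| + 1).
have [x hx] := dense y (`|M| + `|vC y| + 1).
have vx : v x = vC y.
  by rewrite -vemb; apply: (pval_close y0 _ hx); lia.
have x0 : x != 0.
  apply/eqP => xE; move: hx; rewrite xE rmorph0 sub0r vgeN /vge (negPf y0) /=; lia.
rewrite -vx -iP; apply: (@pval_close _ _ _ _ (`|vC y *+ e| + 1)).
- by rewrite fmorph_eq0.
- by rewrite iP vx; lia.
- by rewrite vgeC; apply: hM; apply: vge_le hx; lia.
Qed.

End CompletionMap.

(** * Finite-dimensional subspaces over a complete field *)

Section FiniteDimensional.
Variables (C D : fieldType) (vC : place C) (vD : place D) (k : {rmorphism C -> D}) (e : nat).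
Hypotheses (Ccomplete : forall u : nat -> C, vcauchy vC u -> exists l, vconverges vC u l)
  (e_gt0 : (0 < e)%N) (kP : forall x, vD (k x) = vC x *+ e).
Variable z : nat -> D.

Definition lincomb d (y : D) := exists c : nat -> C, y = \sum_(j < d) k (c j) * z j.

Let lincombB d x y : lincomb d x -> lincomb d y -> lincomb d (x - y).
Proof.
move=> [a ->] [b ->]; exists (fun j => a j - b j); rewrite -sumrB.
by apply: eq_bigr => j _; rewrite rmorphB mulrBl.
Qed.

Let lincombZ d x a : lincomb d x -> lincomb d (k a * x).
Proof.
move=> [b ->]; exists (fun j => a * b j); rewrite mulr_sumr.
by apply: eq_bigr => j _; rewrite rmorphM mulrA.
Qed.

Let lincombSP d y : lincomb d.+1 y <-> exists c m, lincomb d m /\ y = m + k c * z d.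
Proof.
split=> [[c ->]|[c [_ [[b ->] ->]]]].
  by rewrite big_ord_recr /=; exists (c d), (\sum_(j < d) k (c j) * z j); split=> //; exists c.
exists (fun j => if (j < d)%N then b j else c); rewrite big_ord_recr /= ltnn.
by congr (_ + _); apply: eq_bigr => j _; rewrite ltn_ord.
Qed.

(** If [z d] is outside the span of its predecessors, the coefficients on [z d] of a Cauchy sequence
    are themselves Cauchy; removing their limit reduces to [d] vectors. *)
Lemma lincomb_complete d (u : nat -> D) :
  (forall n, lincomb d (u n)) -> vcauchy vD u ->
  exists2 l, lincomb d l & vconverges vD u l.
Proof.
elim: d u => [|d IH] u ud uC.
  exists 0; first by exists (fun=> 0); rewrite big_ord0.
  by move=> N; exists 0%N => i _; have [c ->] := ud i; rewrite big_ord0 vcloseE subrr vge0.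
have [zd|zd] := pselect (lincomb d (z d)).
  have sub y : lincomb d.+1 y -> lincomb d y.
    move=> /lincombSP[c [m [md ->]]]; rewrite -[k c * _]opprK -mulNr -rmorphN.
    by apply: lincombB => //; exact: lincombZ.
  have [l ld lu] := IH u (fun n => sub _ (ud n)) uC; exists l => //.
  by apply/lincombSP; exists 0, l; rewrite rmorph0 mul0r addr0.
(* the distance from z d to the span of the previous vectors is positive *)
have [N NP] : exists N : int, forall m, lincomb d m -> ~~ vge vD N (z d - m).
  apply: contrapT => H.
  have H2 (n : nat) : exists m, lincomb d m /\ vge vD n%:Z (z d - m).
    apply: contrapT => H3; apply: H; exists n%:Z => m md; apply/negP => hm.
    by apply: H3; exists m.
  have [m mP] := choice H2.
  have [| |l ld lm] := IH m; first by move=> n; have [] := mP n.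
    move=> N; exists `|N|%N => a b ha hb; rewrite vcloseE.
    apply: (vge_trans (y := z d)); [rewrite vgeC|].
      by have [_ h] := mP a; apply: vge_le h; lia.
    by have [_ h] := mP b; apply: vge_le h; lia.
  apply: zd; suff -> : z d = l by [].
  apply: (vlim_unique (v := vD) (u := m)) => // N; exists `|N|%N => a ha.
  by rewrite vcloseE vgeC; have [_ h] := mP a; apply: vge_le h; lia.
have [c cP] := choice (fun n => (lincombSP d (u n)).1 (ud n)).
have [m mP] := choice cP.
(* If [k b] were too large, dividing [x + k b * z d] by it would put [z d] within [N] of the smaller
   span. *)
have small M x b : lincomb d x -> vge vD M (x + k b * z d) -> vge vD (M - N) (k b).
  move=> xd h; have [->|b0] := eqVneq b 0; first by rewrite rmorph0 vge0.
  have kb0 : k b != 0 by rewrite fmorph_eq0.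
  rewrite /vge (negPf kb0) /= leNgt; apply/negP => lt.
  have xd' : lincomb d (- (k b^-1 * x)).
    rewrite -mulrN; apply: lincombZ; rewrite -sub0r; apply: lincombB => //.
    by exists (fun=> 0); rewrite big1 // => j _; rewrite rmorph0 mul0r.
  have /negP := NP _ xd'; apply.
  have -> : z d - - (k b^-1 * x) = k b^-1 * (x + k b * z d).
    by rewrite fmorphV mulrDr mulrA mulVf // mul1r opprK addrC.
  apply: vge_le (vgeM (vge_val vD _) h).
  by move: lt; rewrite fmorphV pvalV; move: (vD (k b)) => q; lia.
have cC : vcauchy vC c.
  move=> M; have [n0 n0P] := uC (`|M| *+ e + N).
  exists n0 => a b ha hb; have := n0P a b ha hb; rewrite !vcloseE.
  have [ma ->] := mP a; have [mb ->] := mP b.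
  have -> : m a + k (c a) * z d - (m b + k (c b) * z d) = (m a - m b) + k (c a - c b) * z d.
    by rewrite rmorphB; ring.
  move/(small _ _ _ (lincombB ma mb)); rewrite addrK /vge fmorph_eq0 kP => /orP[->//|h].
  apply/orP; right; apply: le_trans (ler_norm M) _.
  by move: h; rewrite lerMn2r eqn0Ngt e_gt0.
have [cl clP] := Ccomplete cC.
have kc M : exists n0 : nat, forall a : nat, (n0 <= a)%N -> vge vD M (k (c a) * z d - k cl * z d).
  have [n0 n0P] := clP (`|M - vD (z d)|); exists n0 => a /n0P; rewrite vcloseE -mulrBl -rmorphB => h.
  have h2 : vge vD (M - vD (z d)) (k (c a - cl)).
    move: h; rewrite /vge fmorph_eq0 kP => /orP[->//|h]; apply/orP; right.
    by move: h; move: (vC (c a - cl)) (vD (z d)) => q1 q2 h; nia.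
  by apply: vge_le (vgeM h2 (vge_val vD _)); lia.
have mE n : m n = u n - k (c n) * z d by have [_ ->] := mP n; rewrite addrK.
have [| |l ld lm] := IH m; first by move=> n; have [] := mP n.
  move=> M; have [n0 n0P] := uC M; have [n1 n1P] := kc M.
  exists (maxn n0 n1) => a b; rewrite !geq_max => /andP[a0 a1] /andP[b0 b1].
  rewrite vcloseE !mE.
  have -> : u a - k (c a) * z d - (u b - k (c b) * z d) =
    (u a - u b) - ((k (c a) * z d - k cl * z d) - (k (c b) * z d - k cl * z d)) by ring.
  have := n0P a b a0 b0; rewrite vcloseE => h.
  by apply: vgeB => //; apply: vgeB; exact: n1P.
exists (l + k cl * z d); first by apply/lincombSP; exists cl, l.
move=> M; have [n0 n0P] := lm M; have [n1 n1P] := kc M.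
exists (maxn n0 n1) => a; rewrite geq_max => /andP[a0 a1].
have [_ ->] := mP a; rewrite vcloseE.
have -> : m a + k (c a) * z d - (l + k cl * z d) = (m a - l) + (k (c a) * z d - k cl * z d) by ring.
by apply: vgeD; [have := n0P a a0; rewrite vcloseE | exact: n1P].
Qed.

Lemma lincomb_dense d :
  (forall y N, exists2 x, lincomb d x & vge vD N (x - y)) -> forall y, lincomb d y.
Proof.
move=> H y.
have H2 (n : nat) : exists x, lincomb d x /\ vge vD n%:Z (x - y).
  by have [x] := H y n%:Z; exists x.
have [x xP] := choice H2.
have xy N : exists n0 : nat, forall a : nat, (n0 <= a)%N -> vge vD N (x a - y).
  by exists `|N|%N => a ha; have [_ h] := xP a; apply: vge_le h; lia.
have [| |l ld lx] := @lincomb_complete d x; first by move=> n; have [] := xP n.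
  move=> N; have [n0 n0P] := xy N; exists n0 => a b ha hb; rewrite vcloseE.
  by apply: (vge_trans (n0P a ha)); rewrite vgeC n0P.
suff -> : y = l by [].
apply: (vlim_unique (v := vD) (u := x)) => // N.
by have [n0 n0P] := xy N; exists n0 => a ha; rewrite vcloseE n0P.
Qed.

End FiniteDimensional.

(** * Artin-Schreier equations over a complete field *)

Section LocalArtinSchreier.
Variables (C : fieldType) (vC : place C) (p : nat).
Hypotheses (Ccomplete : forall u : nat -> C, vcauchy vC u -> exists l, vconverges vC u l)
  (charC : p \in [pchar C]).

(* The solution is - (y + y^p + y^(p^2) + ...). *)
Lemma complete_artin_schreier y : vge vC 1 y -> exists2 x, vge vC 1 x & x ^+ p - x = y.
Proof.
move=> y1; have p_gt1 : (1 < p)%N := prime_gt1 (pcharf_prime charC).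
pose u n := - \sum_(i < n) y ^+ (p ^ i).
have step n : u n.+1 = u n - y ^+ (p ^ n) by rewrite /u big_ord_recr opprD.
have uF n : u n ^+ p - u n = y - y ^+ (p ^ n).
  elim: n => [|n IH]; first by rewrite /u big_ord0 oppr0 expr0n expr1 subrr; case: p p_gt1 => // q _; rewrite subrr.
  rewrite step -!(pFrobenius_autE charC) rmorphB /= !pFrobenius_autE -exprM -expnSr.
  have -> : u n ^+ p - y ^+ (p ^ n.+1) - (u n - y ^+ (p ^ n)) =
    (u n ^+ p - u n) + y ^+ (p ^ n) - y ^+ (p ^ n.+1) by ring.
  by rewrite IH subrK.
have pw (n : nat) : vge vC n%:Z (y ^+ (p ^ n)).
  move: y1; rewrite /vge expf_eq0 expn_gt0 (ltnW p_gt1) /= pvalX => /orP[->//|h].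
  apply/orP; right; have := ltn_expl n p_gt1; nia.
have uC a d : vge vC a%:Z (u (a + d)%N - u a).
  elim: d => [|d IH]; first by rewrite addn0 subrr vge0.
  rewrite addnS step addrAC; apply: vgeB => //; apply: vge_le (pw _); lia.
have uC2 (n a : nat) : (n <= a)%N -> vge vC n%:Z (u a - u n).
  by move=> h; have := uC n (a - n)%N; rewrite subnKC.
have [|l lP] := Ccomplete (u := u).
  move=> N; exists `|N|%N => a b ha hb; rewrite vcloseE; apply: (@vge_le _ _ `|N|); first by lia.
  by apply: (vge_trans (uC2 _ _ ha)); rewrite vgeC uC2.
have u1 n : vge vC 1 (u n).
  rewrite /u vgeN; apply: vge_sum => i _; move: y1.
  rewrite /vge expf_eq0 expn_gt0 (ltnW p_gt1) /= pvalX => /orP[->//|h].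
  by apply/orP; right; have : (0 < p ^ i)%N by [rewrite expn_gt0 ltnW]; nia.
have l1 : vge vC 1 l.
  have [n0 /(_ n0 (leqnn _))] := lP 1; rewrite vcloseE vgeC => h.
  by rewrite -(subrK (u n0) l); apply: vgeD.
exists l => //; apply/eqP; rewrite -subr_eq0; apply/eqP/(vge_eq0 (v := vC)) => N.
have [n0 n0P] := lP (`|N|); pose n := maxn n0 `|N|%N.
have h1 := n0P n (leq_maxl _ _); rewrite vcloseE vgeC in h1.
have -> : l ^+ p - l - y = ((l - u n) ^+ p - (l - u n)) - y ^+ (p ^ n).
  rewrite -!(pFrobenius_autE charC) rmorphB /= !pFrobenius_autE.
  have E : y = u n ^+ p - u n + y ^+ (p ^ n) by rewrite uF subrK.
  by rewrite {1}E; ring.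
apply: vgeB; last by apply: vge_le (pw n); rewrite /n; lia.
apply: (@vge_le _ _ `|N|); first by lia.
apply: vgeB => //; move: h1; rewrite /vge expf_eq0 (ltnW p_gt1) /= pvalX => /orP[->//|h].
by apply/orP; right; nia.
Qed.

End LocalArtinSchreier.

(** * Extensions and splitting fields *)

(** Evaluation at [zA] presents [A] as a quotient of the polynomial ring over [C]. Only ring
    morphisms from [C] are involved, because one use takes for [A] a completion that carries no
    extension structure over [C]. *)
Lemma eval_morphism (C A B : fieldType) (kA : {rmorphism C -> A}) (kB : {rmorphism C -> B})
    (zA : A) (zB : B) :
  (forall y : A, exists P : {poly C}, y = (map_poly kA P).[zA]) ->
  (forall P : {poly C}, (map_poly kA P).[zA] = 0 -> (map_poly kB P).[zB] = 0) ->
  exists f : {rmorphism A -> B},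
    forall P : {poly C}, f (map_poly kA P).[zA] = (map_poly kB P).[zB].
Proof.
move=> gen rel; have [P PE] := choice gen.
have well Q1 Q2 : (map_poly kA Q1).[zA] = (map_poly kA Q2).[zA] ->
    (map_poly kB Q1).[zB] = (map_poly kB Q2).[zB].
  move=> E; apply/eqP; rewrite -subr_eq0 -hornerN -hornerD -!rmorphN -rmorphD; apply/eqP.
  by apply: rel; rewrite rmorphB hornerD hornerN E subrr.
pose f y := (map_poly kB (P y)).[zB].
have fE Q : f (map_poly kA Q).[zA] = (map_poly kB Q).[zB] by apply: well; rewrite -PE.
have fB : zmod_morphism f.
  move=> x y; rewrite -!hornerN -hornerD -rmorphB -fE.
  by congr f; rewrite rmorphB hornerD hornerN -!PE.
have fM : monoid_morphism f.
  split=> [|x y].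
    by have := fE 1; rewrite !rmorph1 !hornerC.
  by rewrite -hornerM -rmorphM -fE; congr f; rewrite rmorphM hornerM -!PE.
pose fA := GRing.isZmodMorphism.Build A B f fB.
pose fR := GRing.isMonoidMorphism.Build A B f fM.
pose g : {rmorphism A -> B} := HB.pack f fA fR.
by exists g.
Qed.

Section OverBase.
Variables (K : fieldType) (L : fieldExtType K).
Implicit Types (x y z : L).

Lemma minPoly1P x : exists2 h : {poly K}, h \is monic & map_poly (in_alg L) h = minPoly 1 x.
Proof.
have /polyOver1P[h hE] := minPolyOver 1 x; exists h; rewrite -?hE //.
by rewrite -(map_monic (in_alg L)) -hE monic_minPoly.
Qed.

Lemma adjoin1_full_poly z y : (<<1; z>> = {:L})%VS ->
  exists P : {poly K}, (size P <= \dim {:L})%N /\ y = (map_poly (in_alg L) P).[z].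
Proof.
move=> gen; have /polyOver1P[P PE] := Fadjoin_polyOver 1 z y.
exists P; rewrite -PE Fadjoin_poly_eq ?gen ?memvf //; split=> //.
rewrite -(size_map_poly (in_alg L)) -PE; apply: leq_trans (size_Fadjoin_poly _ _ _) _.
by rewrite adjoin_degreeE dimv1 divn1 gen.
Qed.

Lemma adjoin1_morphism (B : fieldType) (kB : {rmorphism K -> B}) z (zB : B) (h : {poly K}) :
  (<<1; z>> = {:L})%VS -> map_poly (in_alg L) h = minPoly 1 z -> root (map_poly kB h) zB ->
  exists f : {rmorphism L -> B}, (forall a, f a%:A = kB a) /\ f z = zB.
Proof.
move=> gen hE hB.
have [| |f fE] := @eval_morphism K L B (in_alg L) kB z zB.
- by move=> y; have [P [_ ->]] := adjoin1_full_poly y gen; exists P.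
- move=> P P0; have : minPoly 1 z %| map_poly (in_alg L) P.
    apply: minPoly_dvdp; last exact/rootP.
    by apply/polyOver1P; exists P.
  rewrite -hE dvdp_map -(dvdp_map kB).
  by move=> /dvdpP[q ->]; rewrite hornerM (rootP hB) mulr0.
- exists f; split=> [a|]; first by have := fE a%:P; rewrite !map_polyC !hornerC.
  by have := fE 'X; rewrite !map_polyX !hornerX.
Qed.

End OverBase.

Lemma galois_primitive (K : fieldType) (L : splittingFieldType K) :
  galois 1 {:L} -> exists z : L, (<<1; z>> = {:L})%VS.
Proof.
by case/and3P=> s1 sep _; exists (separable_generator 1 {:L}); rewrite -eq_adjoin_separable_generator.
Qed.

Lemma galois_splits (K : fieldType) (L : splittingFieldType K) (z : L) (h : {poly K}) :
   map_poly (in_alg L) h = minPoly 1 z ->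
  exists r : seq (gal_of {:L}), map_poly (in_alg L) h = \prod_(s <- r) ('X - (s z)%:P).
Proof.
move=> ->; have /normalField_factors := normalFieldf (1%AS : {subfield L}).
by move=> /(_ (sub1v _) z (memvf _))[r _ ->]; exists r.
Qed.

Lemma dvdp_split_root (F : fieldType) (d : {poly F}) (rs : seq F) :
  d %| \prod_(r <- rs) ('X - r%:P) -> (1 < size d)%N -> exists x, root d x.
Proof.
move=> /dvdp_prod_XsubC[m]; set s := mask m rs => E; rewrite (eqp_size E) size_prod_XsubC.
move: E; case: s => // x s E _; exists x; rewrite (eqp_root E) root_prod_XsubC.
by rewrite inE eqxx.
Qed.

Lemma irreducible_factor (F : fieldType) (f : {poly F}) :
  (1 < size f)%N -> exists2 h, irreducible_poly h & h %| f.
Proof.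
have [k] := ubnP (size f); elim: k f => // k IH f lek f1.
have [|nirr] := pselect (irreducible_poly f); first by exists f.
have [q [q1 qf nq]] : exists q : {poly F}, [/\ size q != 1, q %| f & ~~ (q %= f)].
  apply: contrapT => H; apply: nirr; split=> // q q1 qf; apply/negP => nq.
  by apply: H; exists q; split=> //; apply/negP.
have f0 : f != 0 by rewrite -size_poly_gt0 ltnW.
have q0 : q != 0 by apply: dvdpN0 qf f0.
have lt : (size q < size f)%N.
  by rewrite ltn_neqAle dvdp_leq // andbT dvdp_size_eqp.
have [||h hi hq] := IH q.
- by apply: leq_trans lt _; rewrite -ltnS.
- by rewrite ltn_neqAle eq_sym q1 size_poly_gt0.
- by exists h => //; exact: dvdp_trans hq qf.
Qed.

Lemma exists_root_extension (F : fieldType) (f : {poly F}) : (1 < size f)%N ->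
  exists (L : fieldExtType F) (z : L), root (map_poly (in_alg L) f) z.
Proof.
move=> /irreducible_factor[h hi /dvdpP[q ->]]; have [L _ [z hz _]] := irredp_FAdjoin hi.
by exists L, z; rewrite rmorphM rootM hz orbT.
Qed.

Lemma exists_splitting_extension (F : fieldType) (f : {poly F}) : f != 0 ->
  exists (L : fieldExtType F) (rs : seq L),
    map_poly (in_alg L) f %= \prod_(r <- rs) ('X - r%:P).
Proof.
have [k] := ubnP (size f); elim: k F f => // k IH F f lek f0.
have [f1|f1] := leqP (size f) 1.
  exists F^o, [::]; rewrite big_nil -size_poly_eq1 size_map_poly.
  by rewrite eqn_leq f1 size_poly_gt0.
have [L [z /factor_theorem[q qE]]] := exists_root_extension f1.
have fL0 : map_poly (in_alg L) f != 0 by rewrite map_poly_eq0.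
have q0 : q != 0 by apply: contraNneq fL0 => q0; rewrite qE q0 mul0r.
have [|M [rs rsE]] := IH L q _ q0.
  rewrite -(size_map_poly (in_alg L)) qE size_mul ?polyXsubC_eq0 // size_XsubC addn2 /= in lek.
  exact: lek.
exists (baseFieldType M), (in_alg M z :: rs).
have -> : map_poly (in_alg (baseFieldType M)) f = map_poly (in_alg M) (map_poly (in_alg L) f).
  by rewrite -map_poly_comp; apply: eq_map_poly => a; exact: baseField_scaleE.
rewrite qE rmorphM /= map_polyXsubC big_cons mulrC.
by rewrite eqp_mul2l ?polyXsubC_eq0.
Qed.

Lemma exists_splitting_field (F : fieldType) (f : {poly F}) : f != 0 ->
  exists L : splittingFieldType F, splittingFieldFor 1 (map_poly (in_alg L) f) {:L}.
Proof.
move=> /exists_splitting_extension[M [ys ysE]].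
pose E : {subfield M} := <<1 & ys>>%AS; pose L := subvs_of E.
pose i : {lrmorphism L -> M} := vsval : {lrmorphism L -> M}.
pose zs : seq L := map (vsproj E) ys.
have zsE : map i zs = ys.
  rewrite -map_comp map_id_in // => y yE; rewrite /= vsprojK //.
  exact: seqv_sub_adjoin.
have iA (a : F) : i a%:A = a%:A by rewrite linearZ rmorph1.
have split1 : splittingFieldFor 1 (map_poly (in_alg L) f) {:L}.
  exists zs.
    rewrite -(eqp_map i) rmorph_prod -map_poly_comp.
    rewrite (eq_map_poly (g := in_alg M)); last by move=> a; exact: iA.
    rewrite -zsE big_map in ysE; rewrite (eqp_trans ysE) //.
    suff -> : \prod_(z <- zs) ('X - (i z)%:P) = \prod_(z <- zs) map_poly i ('X - z%:P) by exact: eqpxx.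
    by apply: eq_bigr => z _; rewrite [RHS]map_polyXsubC.
  apply/vspaceP => u; rewrite memvf.
  have : (linfun i) u \in (linfun i @: <<1 & zs>>)%VS.
    rewrite aimg_adjoin_seq aimg1 (eq_map (lfunE i)) zsE lfunE; exact: subvsP.
  by case/memv_imgP => w wE; rewrite !lfunE => /val_inj ->.
have ax : SplittingField.axiom L.
  by exists (map_poly (in_alg L) f) => //; apply/polyOver1P; exists f.
pose S : splittingFieldType F := HB.pack L (FieldExt_isSplittingField.Build F L ax).
by exists S.
Qed.

(** * Enlarging a Galois extension by roots of polynomials *)

Section GaloisAdjoin.
Variables (K : fieldType) (Om : splittingFieldType K).
Hypothesis galOm : galois 1 {:Om}.

(** [Om2] is the splitting field of a separable common multiple [q] of [f] and of the minimal
    polynomial [h] of a primitive element of [Om]. As [h] is irreducible, either it divides [f] and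
    [q = f], or the two are coprime and [q = h * f]. Sending the primitive element to a root of [h]
    embeds [Om]. *)
Lemma galois_adjoin_split (f : {poly K}) : separable_poly f ->
  exists (Om2 : splittingFieldType K) (j : {rmorphism Om -> Om2}),
    [/\ galois 1 {:Om2}, forall a, j a%:A = a%:A
      & exists rs, map_poly (in_alg Om2) f %= \prod_(r <- rs) ('X - r%:P)].
Proof.
move=> sf; have [z zgen] := galois_primitive galOm.
have [h hm hE] := minPoly1P z.
have sh : separable_poly h.
  rewrite -(separable_map (in_alg Om)) hE.
  by have /and3P[_ /separableP sep _] := galOm; exact: (sep z (memvf _)).
have [q [sq hq fq]] : exists q : {poly K}, [/\ separable_poly q, h %| q & f %| q].
  have [hf|nhf] := boolP (h %| f); first by exists f; rewrite hf.
  exists (h * f); rewrite dvdp_mulr // dvdp_mull //; split=> //.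
  rewrite separable_mul sh sf /=.
  have := minPoly_irr (K := 1%AS) (x := z) (p := map_poly (in_alg Om) (gcdp h f)).
  rewrite -hE dvdp_map dvdp_gcdl eqp_map => /(_ _ isT)/orP[].
  - by apply/polyOver1P; exists (gcdp h f).
  - by move=> /eqp_dvdl hd; case/negP: nhf; rewrite -hd dvdp_gcdr.
  - by rewrite -(rmorph1 (map_poly (in_alg Om))) eqp_map gcdp_eqp1.
have [Om2 split2] := exists_splitting_field (separable_poly_neq0 sq).
have [rs rsE rsgen] := split2.
have hrs : map_poly (in_alg Om2) h %| \prod_(r <- rs) ('X - r%:P).
  by rewrite -(eqp_dvdr _ rsE) dvdp_map.
have frs : map_poly (in_alg Om2) f %| \prod_(r <- rs) ('X - r%:P).
  by rewrite -(eqp_dvdr _ rsE) dvdp_map.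
have [|zB hzB] := dvdp_split_root hrs.
  by rewrite size_map_poly -(size_map_poly (in_alg Om)) hE size_minPoly.
have [j [jK jz]] := adjoin1_morphism zgen hE hzB.
exists Om2, j; split=> //.
- apply/splitting_galoisField; exists (map_poly (in_alg Om2) q); split=> //.
    by apply/polyOver1P; exists q.
  by rewrite separable_map.
- by have [m mE] := dvdp_prod_XsubC frs; exists (mask m rs).
Qed.

(** Since [c] need not lie in [K], the field stays Galois over [K] by splitting [h ('X^p - 'X)],
    with [h] the minimal polynomial of [c]. This is separable because ['X^p - 'X] has derivative
    -1. *)
Lemma galois_adjoin_artin_schreier p (c : Om) : p \in [pchar K] ->
  exists (Om2 : splittingFieldType K) (j : {rmorphism Om -> Om2}),
    [/\ galois 1 {:Om2}, forall a, j a%:A = a%:A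
      & exists x : Om2, x ^+ p - x = j c].
Proof.
move=> charK; have p_gt1 := prime_gt1 (pcharf_prime charK).
have [h hm hE] := minPoly1P c; pose g : {poly K} := 'X^p - 'X.
have sh : separable_poly h.
  rewrite -(separable_map (in_alg Om)) hE.
  by have /and3P[_ /separableP sep _] := galOm; exact: (sep c (memvf _)).
have g' : g^`() = (-1)%:P.
  rewrite derivB derivXn derivX -mulr_natr -polyC_natr (pcharf0 charK) mulr0 sub0r.
  by rewrite rmorphN.
have [|Om2 [j [gal2 jK [rs rsE]]]] := galois_adjoin_split (f := h \Po g).
  rewrite separable_poly.unlock in sh *; rewrite deriv_comp g' coprimepMr coprimep_comp_poly //=.
  by rewrite -alg_polyC coprimepZr ?coprimep1 ?oppr_eq0 ?oner_neq0.
exists Om2, j; split=> //.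
pose d : {poly Om2} := 'X^p - 'X - (j c)%:P.
have : root (map_poly (in_alg Om2) h) (j c).
  rewrite /root; have <- : j ((map_poly (in_alg Om) h).[c]) = (map_poly (in_alg Om2) h).[j c].
    rewrite -horner_map -map_poly_comp; congr (_.[_]).
    by apply: eq_map_poly => a /=; rewrite jK.
  by rewrite hE minPolyxx rmorph0.
move=> /factor_theorem[q qE].
have dd : d %| \prod_(r <- rs) ('X - r%:P).
  rewrite -(eqp_dvdr _ rsE) map_comp_poly qE comp_polyM dvdp_mull //.
  by rewrite comp_polyB comp_polyX comp_polyC rmorphB /= map_polyXn map_polyX.
have sd : size d = p.+1.
  rewrite /d -addrA -opprD size_addl ?size_polyXn // size_opp.
  by rewrite size_XaddC.
have [|x /rootP] := dvdp_split_root dd; first by rewrite sd; lia.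
rewrite /d !hornerE => /eqP; rewrite subr_eq0 => /eqP xE; by exists x.
Qed.

End GaloisAdjoin.

Lemma subfield_splitting (K : fieldType) (Om : splittingFieldType K) (E : {subfield Om}) :
  galois 1 {:Om} -> normalField 1 E ->
  exists (L : splittingFieldType K) (i : {lrmorphism L -> Om}),
    galois 1 {:L} /\ forall y, (y \in E) <-> exists x, y = i x.
Proof.
move=> galOm nE; pose L := subvs_of E.
pose i : {lrmorphism L -> Om} := vsval : {lrmorphism L -> Om}.
have iE (x : L) : i x \in E := subvsP x.
have minE (x : L) : map_poly i (minPoly 1 x) = minPoly 1 (i x).
  have := map_minPoly (linfun i) 1%AS x.
  rewrite aimg1 lfunE (eq_map_poly (g := i)) //; exact: lfunE.
have ax : SplittingField.axiom L.
  apply: normal_field_splitting => K0 x.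
  have /normalField_factors := nE; move=> /(_ (sub1v _) (i x) (iE x))[r _].
  set zs := [seq vsproj E (s (i x)) | s : gal_of E <- r] => rE.
  have Ez : minPoly 1 x = \prod_(z <- zs) ('X - z%:P).
    apply: (map_poly_inj i); rewrite minE rE big_map rmorph_prod; apply: eq_bigr => s _.
    rewrite [RHS]map_polyXsubC; congr ('X - _%:P); apply/esym.
    exact/vsprojK/memv_gal/iE.
  have : minPoly K0 x %| \prod_(z <- zs) ('X - z%:P) by rewrite -Ez minPolyS // sub1v.
  case/dvdp_prod_XsubC => m mE; exists (mask m zs).
  by rewrite -eqp_monic ?monic_minPoly ?monic_prod_XsubC.
pose S : splittingFieldType K := HB.pack L (FieldExt_isSplittingField.Build K L ax).
exists S, i; split.
  apply/and3P; split; rewrite ?sub1v ?normalFieldf //.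
  apply/separableP => x _; rewrite /separable_element -(separable_map i) minE.
  by have /and3P[_ /separableP sep _] := galOm; exact: sep (memvf _).
move=> y; split=> [yE|[x ->]]; last exact: iE.
by exists (vsproj E y); rewrite /= vsprojK.
Qed.

(** * Truncated polynomials and Lang's equation *)

Section TruncatedPoly.
Variables (R : comNzRingType) (N : nat).
Implicit Types f g h : {poly R}.

(** Equality in R[t]/(t^N), kept as a relation on polynomials so that ring morphisms act on
    coefficients without a change of quotient ring. *)
Definition eqX f g := forall k, (k < N)%N -> f`_k = g`_k.

Lemma eqX_refl f : eqX f f. Proof. by []. Qed.

Lemma eqX_sym f g : eqX f g -> eqX g f.
Proof. by move=> h k kN; rewrite h. Qed.

Lemma eqX_trans g f h : eqX f g -> eqX g h -> eqX f h.
Proof. by move=> h1 h2 k kN; rewrite h1 ?h2. Qed.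

Lemma eqXM f f' g g' : eqX f f' -> eqX g g' -> eqX (f * g) (f' * g').
Proof.
move=> hf hg k kN; rewrite !coefM; apply: eq_bigr => i _.
by rewrite hf ?hg //; have := ltn_ord i; lia.
Qed.

Lemma eqXMl f g g' : eqX g g' -> eqX (f * g) (f * g').
Proof. exact: eqXM. Qed.

Lemma eqXMr f g g' : eqX g g' -> eqX (g * f) (g' * f).
Proof. by move=> h; exact: eqXM. Qed.

Lemma eqX_exp_Xmul f g n : (N <= n)%N -> eqX (f + 'X^n * g) f.
Proof. by move=> Nn k kN; rewrite coefD coefXnM (leq_trans kN Nn) addr0. Qed.

Lemma coef0_1_factor f : f`_0 = 1 -> exists q, f = 1 + 'X * q.
Proof.
move=> f0; have : root (f - 1) 0.
  by rewrite /root hornerD hornerN horner_coef0 hornerC f0 subrr.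
case/factor_theorem => q; rewrite subr0 => E; exists q.
by rewrite mulrC -E addrC subrK.
Qed.

Lemma eqX_inv f : f`_0 = 1 -> exists2 g : {poly R}, g`_0 = 1 & eqX (f * g) 1.
Proof.
move=> /coef0_1_factor[q ->].
(* Geometric series; with [N.+1] terms the constant coefficient is 1 even when [N = 0]. *)
exists (\sum_(i < N.+1) (- ('X * q)) ^+ i).
  rewrite coef_sum big_ord_recl expr0 coef1 eqxx big1 ?addr0 // => i _.
  by rewrite exprS mulNr -mulrA coefN coefXM oppr0.
set x := - ('X * q); have -> : 1 + 'X * q = - (x - 1) by rewrite /x; ring.
rewrite mulNr -subrX1 opprB /x exprNn exprMn mulrCA -mulrN.
by apply: eqX_exp_Xmul.
Qed.

Lemma eqX_cancel f g h : f`_0 = 1 -> eqX (f * g) (f * h) -> eqX g h.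
Proof.
move=> /eqX_inv[i _ fi] E.
have {}fi k : eqX (i * (f * k)) k.
  rewrite mulrA (mulrC i) -{2}[k]mul1r; exact: eqXMr.
by apply: eqX_trans (eqX_sym (fi g)) _; apply: eqX_trans (fi h); apply: eqXMl.
Qed.

End TruncatedPoly.

Lemma eqX_map (R S : comNzRingType) (j : {rmorphism R -> S}) N f g :
  eqX N f g -> eqX N (map_poly j f) (map_poly j g).
Proof. by move=> h k kN; rewrite !coef_map h. Qed.

Lemma eqX_map_inj (R S : fieldType) (j : {rmorphism R -> S}) N f g :
  eqX N (map_poly j f) (map_poly j g) -> eqX N f g.
Proof. by move=> h k kN; have := h k kN; rewrite !coef_map => /fmorph_inj. Qed.

(** * Frobenius and the solutions of Lang's equation *)

Section Frobenius.
Variables (p : nat) (R : fieldType).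
Hypothesis charR : p \in [pchar R].

Definition frob : {poly R} -> {poly R} := map_poly (pFrobenius_aut charR).

Lemma coef_frob f k : (frob f)`_k = f`_k ^+ p.
Proof. by rewrite coef_map /= pFrobenius_autE. Qed.

Lemma frobM f g : frob (f * g) = frob f * frob g. Proof. exact: rmorphM. Qed.

Lemma frob_X1 k : frob ((1 + 'X) ^+ k) = (1 + 'X) ^+ k.
Proof. by rewrite /frob rmorphXn rmorphD rmorph1 /= map_polyX. Qed.

Lemma eqX_frob N f g : eqX N f g -> eqX N (frob f) (frob g).
Proof. exact: eqX_map. Qed.

Definition lang_solution N (a b : {poly R}) := b`_0 = 1 /\ eqX N (frob b) (a * b).

(** As [a] has constant coefficient 1, comparing coefficients at ['X^n] leaves x^p = x + (a c)_n;
    lower coefficients are unaffected by the new term. *)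
Lemma lang_solution_step n (a c : {poly R}) x :
  a`_0 = 1 -> eqX n (frob c) (a * c) -> c`_n = 0 -> x ^+ p - x = (a * c)`_n ->
  eqX n.+1 (frob (c + x *: 'X^n)) (a * (c + x *: 'X^n)).
Proof.
move=> a0 h cn hx k; rewrite ltnS leq_eqVlt => /orP[/eqP->|kn].
  rewrite coef_frob !coefD !coefZ cn add0r mulrDr coefD -hx -scalerAr coefZ coefMXn ltnn subnn a0.
  by rewrite coefXn eqxx !mulr1 subrK.
rewrite coef_frob mulrDr -scalerAr !coefD !coefZ coefMXn coefXn kn (ltn_eqF kn) !mulr0 !addr0.
by rewrite -coef_frob h.
Qed.

Let p_pr := pcharf_prime charR.

Let natr_modp n : (n %% (Zp_trunc (pdiv p)).+2)%:R = n%:R :> R.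
Proof.
by rewrite Fp_cast // [in RHS](divn_eq n p) natrD natrM (pcharf0 charR) mulr0 add0r.
Qed.

Definition Fp_to of p \in [pchar R] := fun x : 'F_p => (x : nat)%:R : R.
Local Notation Fp := (Fp_to charR).

Let FpD x y : Fp (x + y) = Fp x + Fp y.
Proof. by rewrite /Fp_to /= natr_modp natrD. Qed.

Fact Fp_to_zmod : zmod_morphism Fp.
Proof. by move=> x y; apply: (addIr (Fp y)); rewrite subrK -FpD subrK. Qed.

Fact Fp_to_monoid : monoid_morphism Fp.
Proof.
split; first by rewrite /Fp_to /= natr_modp.
by move=> x y; rewrite /Fp_to /= natr_modp natrM.
Qed.

HB.instance Definition _ := GRing.isZmodMorphism.Build 'F_p R Fp Fp_to_zmod.
HB.instance Definition _ := GRing.isMonoidMorphism.Build 'F_p R Fp Fp_to_monoid.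

Lemma Fp_to_fixed (y : 'F_p) : Fp y ^+ p = Fp y.
Proof. by rewrite -(pFrobenius_autE charR) rmorph_nat. Qed.

(** ['X^p - 'X] has at most p roots, and the prime field already supplies p of them. *)
Lemma Fp_fixedP (x : R) : x ^+ p = x -> exists y : 'F_p, x = Fp y.
Proof.
move=> hx; pose P : {poly R} := 'X^p - 'X.
have p1 := prime_gt1 p_pr.
have sP : size P = p.+1 by rewrite size_addl ?size_polyXn // size_opp size_polyX.
have P0 : P != 0 by rewrite -size_poly_gt0 sP.
pose rs := [seq Fp y | y <- enum 'F_p].
have rootP y : y ^+ p = y -> root P y by move=> h; rewrite /root !hornerE h subrr.
have [/mapP[y _ ->]|xrs] := boolP (x \in rs); first by exists y.
have := @max_poly_roots _ P (x :: rs) P0.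
rewrite /= rootP //= size_map -cardE card_Fp // sP ltnn xrs map_inj_uniq ?enum_uniq; last exact: fmorph_inj.
have -> : all (root P) rs by apply/allP => _ /mapP[y _ ->]; apply: rootP; exact: Fp_to_fixed.
by move=> /(_ isT isT).
Qed.

Lemma map_Fp_to_X1 k : map_poly Fp ((1 + 'X) ^+ k) = (1 + 'X) ^+ k.
Proof. by rewrite rmorphXn rmorphD rmorph1 /= map_polyX. Qed.

(** Dividing the two equations shows that [b' / b] modulo ['X^N] is fixed by Frobenius, hence has
    coefficients in the prime field. *)
Lemma lang_solution_ratio N (a b b' : {poly R}) : (0 < N)%N ->
  lang_solution N a b -> lang_solution N a b' ->
  exists2 f : {poly 'F_p}, f`_0 = 1 & eqX N b' (b * map_poly Fp f).
Proof.
move=> N0 [b0 hb] [b'0 hb'].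
have [i i0 bi] := eqX_inv N b0; pose g := b' * i.
have gb : eqX N b' (b * g).
  by rewrite /g mulrCA -{1}[b']mulr1; apply: eqXMl; apply: eqX_sym.
have gF : eqX N (frob g) g.
  apply: (eqX_cancel (f := frob b)); first by rewrite coef_frob b0 expr1n.
  rewrite -frobM; apply: eqX_trans (eqX_frob (eqX_sym gb)) _.
  apply: eqX_trans hb' _; apply: eqX_trans (eqXMl _ gb) _; rewrite mulrA.
  by apply: eqXMr; apply: eqX_sym.
have g0 : g`_0 = 1 by rewrite /g coefM big_ord1 subnn b'0 i0 mulr1.
have coefg k : exists y : 'F_p, (k < N)%N -> g`_k = Fp y.
  case: (ltnP k N) => kN; last by exists 0.
  have [|y yE] := @Fp_fixedP g`_k; first by rewrite -coef_frob gF.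
  by exists y.
have [y yE] := choice coefg.
have cE k : (k < N)%N -> (\poly_(k < N) y k)`_k = y k by move=> kN; rewrite coef_poly kN.
exists (\poly_(k < N) y k).
  by apply: (fmorph_inj Fp); rewrite cE // rmorph1; exact: etrans (esym (yE _ N0)) g0.
apply: eqX_trans gb _; apply: eqXMl => k kN.
by rewrite coef_map cE // yE.
Qed.

End Frobenius.

Lemma frob_map p (R S : fieldType) (charR : p \in [pchar R]) (charS : p \in [pchar S])
    (j : {rmorphism R -> S}) f : frob charS (map_poly j f) = map_poly j (frob charR f).
Proof. by apply/polyP => k; rewrite coef_frob !coef_map /= pFrobenius_autE rmorphXn. Qed.

Lemma Fp_to_map p (R S : fieldType) (charR : p \in [pchar R]) (charS : p \in [pchar S])
    (j : {rmorphism R -> S}) f :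
  map_poly j (map_poly (Fp_to charR) f) = map_poly (Fp_to charS) f.
Proof. by rewrite -map_poly_comp; apply: eq_map_poly => x /=; rewrite /Fp_to rmorph_nat. Qed.

Lemma lang_solution_map p (R S : fieldType) (charR : p \in [pchar R]) (charS : p \in [pchar S])
    (j : {rmorphism R -> S}) N a b :
  lang_solution charR N a b -> lang_solution charS N (map_poly j a) (map_poly j b).
Proof.
move=> [b0 h]; split; first by rewrite coef_map /= b0 rmorph1.
by rewrite (frob_map charR) -rmorphM; exact: eqX_map.
Qed.

Lemma X1_pexp p a (R : nzRingType) : p \in [pchar R] ->
  (1 + 'X) ^+ (p ^ a) = 1 + 'X^(p ^ a) :> {poly R}.
Proof.
move=> charR; have charP : p \in [pchar {poly R}] by rewrite pchar_poly.
elim: a => [|a IH]; first by rewrite !expr1.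
rewrite expnSr exprM IH -!(pFrobenius_autE charP) pFrobenius_autD_comm ?rmorph1 //.
  by rewrite pFrobenius_aut1 pFrobenius_autE -exprM.
exact/commr_sym/commr1.
Qed.

Lemma eqX_X1_mod p a (R : comNzRingType) m n : p \in [pchar R] -> m = n %[mod p ^ a] ->
  eqX (p ^ a) ((1 + 'X : {poly R}) ^+ m) ((1 + 'X) ^+ n).
Proof.
move=> charR E.
suff H k : eqX (p ^ a) ((1 + 'X : {poly R}) ^+ k) ((1 + 'X) ^+ (k %% p ^ a)).
  by apply: eqX_trans (H m) _; rewrite E; apply: eqX_sym.
rewrite {1}(divn_eq k (p ^ a)) exprD mulnC exprM X1_pexp // -[X in eqX _ _ X]mul1r.
apply: eqXMr; elim: (k %/ p ^ a)%N => [//|j IH]; rewrite exprS -[X in eqX _ _ X]mul1r.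
by apply: eqXM IH; rewrite -['X^_]mulr1; exact: eqX_exp_Xmul.
Qed.

(** A cyclic subgroup whose order is the exponent of a finite abelian group has a complement; [rho]
    is the exponent of the component along [1 + 'X]. It is defined on all polynomials but means
    something only for constant coefficient 1 and modulo [p ^ a]. *)
Lemma unipotent_retraction p a : prime p ->
  exists rho : {poly 'F_p} -> nat,
    [/\ forall f g : {poly 'F_p}, f`_0 = 1 -> g`_0 = 1 -> rho (f * g) = rho f + rho g %[mod p ^ a],
        forall f g : {poly 'F_p}, f`_0 = 1 -> g`_0 = 1 -> eqX (p ^ a) f g -> rho f = rho g
      & forall k, rho ((1 + 'X) ^+ k) = k %[mod p ^ a]].
Proof.
move=> p_pr; have p1 := prime_gt1 p_pr.
have charF : p \in [pchar 'F_p] by exact: pchar_Fp.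
case: a => [|a]; first by exists (fun=> 0%N); split=> // *; rewrite !modn1.
set N := (p ^ a.+1)%N.
have N1 : (1 < N)%N by rewrite /N -(expn0 p) ltn_exp2l.
pose Q := {poly %/ ('X^N : {poly 'F_p})}; pose q (f : {poly 'F_p}) : Q := in_qpoly 'X^N f.
have mkX : mk_monic ('X^N : {poly 'F_p}) = 'X^N by rewrite mk_monic_Xn prednK // ltnW.
have q1 : q 1 = 1 by exact: in_qpoly1.
have qM f g : q (f * g) = q f * q g by exact: in_qpolyM.
have qX f k : q (f ^+ k) = q f ^+ k.
  by elim: k => [|k IH]; rewrite ?expr0 ?q1 // !exprS qM IH.
have qXN : q 'X^N = 0 by apply/val_inj; rewrite /= mkX Pdiv.RingMonic.rmodpp ?monicXn.
have q_eqX f g : eqX N f g -> q f = q g.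
  move=> fg; apply/eqP; rewrite -subr_eq0 -raddfB /=; apply/eqP.
  rewrite -(poly_take_drop N (f - g)).
  have -> : take_poly N (f - g) = 0.
    by apply/polyP => k; rewrite coef_take_poly coef0; case: ltnP => // kN; rewrite coefB fg // subrr.
  by rewrite add0r; change (q (drop_poly N (f - g) * 'X^N) = 0); rewrite qM qXN mulr0.
have unit_q (f : {poly 'F_p}) : f`_0 = 1 -> q f \is a GRing.unit.
  move=> /(eqX_inv N)[g _ fg]; apply/unitrP; exists (q g).
  by rewrite -!qM (mulrC g) (q_eqX _ _ fg) q1.
pose u (f : {poly 'F_p}) : {unit Q} :=
  if f`_0 == 1 :> 'F_p =P true is ReflectT f0 then FinRing.unit Q (unit_q _ (eqP f0)) else 1%g.
have uE (f : {poly 'F_p}) : f`_0 = 1 -> val (u f) = q f.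
  by move=> f0; rewrite /u; case: eqP => //; rewrite f0 eqxx.
have uM (f g : {poly 'F_p}) : f`_0 = 1 -> g`_0 = 1 -> u (f * g) = (u f * u g)%g.
  move=> f0 g0; apply: val_inj; rewrite FinRing.val_unitM !uE // ?qM //.
  by rewrite coefM big_ord1 subnn f0 g0 mulr1.
have X10 k : ((1 + 'X : {poly 'F_p}) ^+ k)`_0 = 1.
  by rewrite -horner_coef0 horner_exp !hornerE ?addr0 expr1n.
pose x := u (1 + 'X).
have vx : val x = q (1 + 'X) by apply: uE; have := X10 1%N; rewrite expr1.
have uX k : u ((1 + 'X) ^+ k) = (x ^+ k)%g.
  by apply: val_inj; rewrite FinRing.val_unitX vx uE ?X10 // qX.
have cUU : abelian [set: {unit Q}].
  by apply/centsP => y _ z _; apply: val_inj; rewrite !FinRing.val_unitM mulrC.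
(* The N-torsion of the unit group plays the part of U(F_p): it contains every class with constant
   coefficient 1, and its exponent divides [N] by construction. *)
pose G := Group (group_Ldiv N cUU).
have GE y : (y \in G) = (y ^+ N == 1)%g by rewrite !inE.
have uG (f : {poly 'F_p}) : f`_0 = 1 -> u f \in G.
  move=> f0; rewrite GE; apply/eqP/val_inj; rewrite FinRing.val_unitX uE // -qX FinRing.val_unit1 -q1.
  apply: q_eqX; have [g ->] := coef0_1_factor f0.
  have charP : p \in [pchar {poly 'F_p}] by rewrite pchar_poly.
  have -> : (1 + 'X * g) ^+ N = 1 + 'X^N * g ^+ N.
    rewrite /N; elim: (a.+1) => [|k IH]; rewrite ?expr1 // expnSr !exprM IH.
    by rewrite -!(pFrobenius_autE charP) rmorphD rmorph1 rmorphM.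
  exact: eqX_exp_Xmul.
have xG : x \in G by apply: uG; have := X10 1%N; rewrite expr1.
(* Here [N] is [p ^ a.+1]. A smaller order would make [(1 + 'X) ^+ (p ^ a) = 1 + 'X^(p ^ a)] trivial
   modulo ['X^N]. *)
have ox : #[x]%g = N.
  apply/eqP; have /(dvdn_pfactor _ _ p_pr)[m mle mE] : (#[x]%g %| N)%N.
    by rewrite order_dvdn -GE.
  rewrite mE /N eqn_exp2l // eqn_leq mle leqNgt; apply/negP => ma.
  have : (x ^+ (p ^ a) == 1)%g by rewrite -order_dvdn mE dvdn_exp2l.
  rewrite -uX X1_pexp // => /eqP/(congr1 val); rewrite uE; last first.
    by rewrite coefD coef1 coefXn eqxx eq_sym expn_eq0 gtn_eqF ?addr0 // ltnW.
  rewrite FinRing.val_unit1 -q1 => /eqP; rewrite -subr_eq0 -raddfB /= addrC addKr => /eqP /(congr1 val) /=.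
  rewrite Pdiv.Ring.rmodp_small; last by rewrite mkX !size_polyXn ltnS ltn_exp2l.
  by move/eqP; rewrite -size_poly_eq0 size_polyXn.
have expG : #[x]%g = exponent G.
  apply/eqP; rewrite eqn_dvd dvdn_exponent // ox; apply/exponentP => y.
  by rewrite GE => /eqP.
have cGG : abelian G := abelianS (finset.subsetT _) cUU.
have /splitsP[H /complP[tiH defG]] := abelian_splits xG expG cGG.
have dec y : exists n : nat, y \in G -> exists2 h, h \in H & y = (x ^+ n * h)%g.
  have [|ny] := boolP (y \in G); last by exists 0%N.
  rewrite -defG => /mulsgP[_ h /cycleP[n ->] hH ->]; by exists n => _; exists h.
have [e eP] := choice dec.
have uniq m n h1 h2 : h1 \in H -> h2 \in H -> (x ^+ m * h1)%g = (x ^+ n * h2)%g -> m = n %[mod N].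
  move=> h1H h2H E.
  have : ((x ^+ m)^-1 * x ^+ n)%g \in <[x]>%g :&: H.
    rewrite inE; apply/andP; split; first by rewrite groupM ?groupV ?mem_cycle.
    have -> : ((x ^+ m)^-1 * x ^+ n = h1 * h2^-1)%g.
      by apply: (mulgI (x ^+ m)%g); rewrite mulKVg mulgA E mulgK.
    by rewrite groupM ?groupV.
  by rewrite tiH inE -eq_mulVg1 eq_expg_mod_order ox => /eqP.
exists (fun f => e (u f)); split.
- move=> f g f0 g0; have fgG : u (f * g) \in G by rewrite uM // groupM ?uG.
  have [h1 h1H E1] := eP _ (uG f f0); have [h2 h2H E2] := eP _ (uG g g0).
  have [h3 h3H E3] := eP _ fgG.
  apply: (uniq _ _ h3 (h1 * h2)%g); rewrite ?groupM // -E3 uM // [in LHS]E1 [in LHS]E2.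
  rewrite expgD; have cx (y z : {unit Q}) : commute y z by apply: (centsP cUU); rewrite inE.
  by rewrite -!mulgA; congr (_ * _)%g; rewrite !mulgA; congr (_ * _)%g; exact: cx.
- by move=> f g f0 g0 fg; congr e; apply: val_inj; rewrite !uE //; exact: q_eqX.
- move=> k; have [h hH E] := eP _ (uG _ (X10 k)).
  by apply: (uniq _ _ h 1%g) => //; rewrite -E uX mulg1.
Qed.

(** * Lang's equation over local fields *)

Lemma eqX_sum (R : comNzRingType) N (I : Type) (r : seq I) (P : pred I) (f g : I -> {poly R}) :
  (forall i, P i -> eqX N (f i) (g i)) ->
  eqX N (\sum_(i <- r | P i) f i) (\sum_(i <- r | P i) g i).
Proof. by move=> h k kN; rewrite !coef_sum; apply: eq_bigr => i Pi; exact: h. Qed.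

Lemma pchar_ext p (K L : fieldType) (j : {rmorphism K -> L}) :
  p \in [pchar K] -> p \in [pchar L].
Proof. by rewrite !inE => /andP[-> /= /eqP h]; rewrite -(rmorph_nat j) h rmorph0. Qed.

Section GaloisFixed.
Variables (C : fieldType) (L : splittingFieldType C).
Hypothesis galL : galois 1 {:L}.

Lemma gal_fixed_base (y : L) : (forall s : gal_of {:L}, s y = y) -> exists a : C, y = a%:A.
Proof.
move=> h; have /galois_fixedField fixE := galL.
have : y \in fixedField 'Gal({:L} / 1)%g by apply/fixedFieldP => [|s _]; [exact: memvf | exact: h].
by rewrite fixE => /vlineP.
Qed.

Lemma galM_full (s t : gal_of {:L}) (x : L) : (s * t)%g x = t (s x).
Proof. by rewrite galM ?memvf. Qed.

Lemma gal_base (s : gal_of {:L}) (a : C) : s a%:A = a%:A.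
Proof. by rewrite linearZ /= rmorph1. Qed.

Lemma galM_map (s t : gal_of {:L}) (f : {poly L}) :
  map_poly (s * t)%g f = map_poly t (map_poly s f).
Proof. by rewrite -map_poly_comp; apply: eq_map_poly => x; exact: galM_full. Qed.

(** By independence of automorphisms some trace is nonzero; it lies in the base field, so one may
    divide by it. *)
Lemma exists_trace1 : exists x : L, \sum_(s : gal_of {:L}) s x = 1.
Proof.
have [y y0] : exists y : L, \sum_(s : gal_of {:L}) s y != 0.
  apply: contrapT => H.
  have := @gal_independent _ _ {:L}%AS xpredT (fun=> 1) _ 1%g isT.
  move=> /(_ _)/eqP; rewrite oner_eq0 => F; apply: Bool.diff_false_true; apply: F => y _.
  under eq_bigr do rewrite mul1r.
  by apply/eqP/negPn/negP => hy; apply: H; exists y.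
set t := \sum_(s : gal_of {:L}) s y in y0.
have [|a aE] := gal_fixed_base (y := t).
  move=> s; rewrite /t rmorph_sum /= [RHS](reindex_inj (mulIg s)) /=.
  by apply: eq_bigr => u _; rewrite galM_full.
have st (s : gal_of {:L}) : s t = t by rewrite aE gal_base.
exists (y / t); rewrite (eq_bigr (fun s : gal_of {:L} => s y / t)).
  by rewrite -mulr_suml mulfV.
by move=> s _; rewrite rmorphM fmorphV /= st.
Qed.

End GaloisFixed.

Section LocalLang.
Variables (p a : nat) (C : fieldType) (vC : place C) (L : splittingFieldType C).
Hypotheses (charC : p \in [pchar C]) (charL : p \in [pchar L])
  (Ccomplete : forall u : nat -> C, vcauchy vC u -> exists l, vconverges vC u l)
  (galL : galois 1 {:L}).
Variable chi : gal_of {:L} -> nat.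
Hypothesis chiM : forall s t, chi (s * t)%g = chi s + chi t %[mod p ^ a].
Local Notation N := (p ^ a)%N.

Let p_pr := pcharf_prime charC.
Let N0 : (0 < N)%N. Proof. by rewrite expn_gt0 prime_gt0. Qed.

(* Additive Hilbert 90: average the character against an element of trace 1. *)
Lemma character_lang : exists2 b : {poly L}, b`_0 = 1 &
  forall s : gal_of {:L}, eqX N (map_poly s b) (b * (1 + 'X) ^+ chi s).
Proof.
have [x tr1] := exists_trace1 galL.
(* The constant coefficient is the trace of [x]. Applying [t] shifts the index from [s] to [s * t],
   and additivity of [chi] turns the shift into the factor [(1 + 'X) ^+ chi t]. *)
exists (\sum_(s : gal_of {:L}) (s x)%:P * (1 + 'X) ^+ chi s^-1%g).
  rewrite coef_sum -tr1; apply: eq_bigr => s _.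
  by rewrite coefCM -horner_coef0 horner_exp !hornerE ?addr0 expr1n mulr1.
move=> t; rewrite rmorph_sum /= mulr_suml.
have -> : \sum_(s : gal_of {:L}) map_poly t ((s x)%:P * (1 + 'X) ^+ chi s^-1%g) =
   \sum_(s : gal_of {:L}) ((s * t)%g x)%:P * (1 + 'X) ^+ chi s^-1%g.
  apply: eq_bigr => s _; rewrite rmorphM rmorphXn rmorphD rmorph1 /= map_polyX map_polyC.
  by rewrite galM_full.
rewrite [X in eqX _ _ X](reindex_inj (mulIg t)) /=.
apply: eqX_sum => s _; rewrite -mulrA; apply: eqXMl; rewrite -exprD.
by apply: eqX_X1_mod => //; rewrite addnC -chiM invMg mulKVg.
Qed.

(** An automorphism multiplies both [b] and [frob b] by the same power of [1 + 'X], which Frobenius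
    fixes. So their quotient is Galois invariant and descends to [C]. *)
Lemma local_lang_generator (b : {poly L}) : b`_0 = 1 ->
  (forall s : gal_of {:L}, eqX N (map_poly s b) (b * (1 + 'X) ^+ chi s)) ->
  exists2 A : {poly C}, A`_0 = 1 & lang_solution charL N (map_poly (in_alg L) A) b.
Proof.
move=> b0 bs; have [i i0 bi] := eqX_inv N b0.
pose A := frob charL b * i.
have hA : eqX N (frob charL b) (A * b).
  rewrite /A -mulrA (mulrC i) -{1}[frob _ b]mulr1; apply: eqXMl; exact: eqX_sym.
have As (s : gal_of {:L}) : eqX N (map_poly s A) A.
  apply: (eqX_cancel (f := b * (1 + 'X) ^+ chi s)).
    by rewrite coefM big_ord1 subnn b0 -horner_coef0 horner_exp !hornerE ?addr0 expr1n.
  apply: (@eqX_trans _ _ (map_poly s (A * b))).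
    have -> : map_poly s (A * b) = map_poly s b * map_poly s A by rewrite rmorphM mulrC.
    by apply: eqXMr; apply: eqX_sym.
  apply: (@eqX_trans _ _ (map_poly s (frob charL b))); first by apply: eqX_map; apply: eqX_sym.
  rewrite -(frob_map charL).
  apply: eqX_trans (eqX_frob charL (bs s)) _; rewrite frobM frob_X1 mulrAC.
  by apply: eqXMr; rewrite (mulrC b).
have Ac k : exists c : C, (k < N)%N -> A`_k = c%:A.
  case: (ltnP k N) => kN; last by exists 0.
  have [|c cE] := gal_fixed_base galL (y := A`_k); last by exists c.
  by move=> s; rewrite -[RHS](As s k kN) coef_map.
have [c cE] := choice Ac.
have cN k : (k < N)%N -> (map_poly (in_alg L) (\poly_(k < N) c k))`_k = A`_k.
  by move=> kN; rewrite coef_map coef_poly kN cE.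
exists (\poly_(k < N) c k).
  apply: (fmorph_inj (in_alg L)); rewrite -coef_map cN // rmorph1.
  by rewrite /A coefM big_ord1 subnn i0 coef_frob b0 expr1n mulr1.
split=> //; apply: eqX_trans hA _; apply: eqXMr => k kN; by rewrite cN.
Qed.

(* The equation frob c = d c is a chain of Artin-Schreier equations whose right hand sides
   have positive valuation. *)
Lemma small_lang_solution (d : {poly C}) : d`_0 = 1 ->
  (forall k, (0 < k < N)%N -> vge vC 1 d`_k) -> exists c, lang_solution charC N d c.
Proof.
move=> d0 dk.
suff /(_ N (leqnn N) N0)[c [c0 _ _ h]] : forall n, (n <= N)%N -> (0 < n)%N ->
  exists c : {poly C}, [/\ c`_0 = 1, forall k, (0 < k)%N -> vge vC 1 c`_k,
    (forall k, (n <= k)%N -> c`_k = 0) & eqX n (frob charC c) (d * c)] by exists c.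
have v1 : vge vC 0 1 by rewrite /vge pval1 lexx orbT.
elim=> [//|[|n] IH] nN _.
  exists 1; split=> [|k k0|k k0|k]; first by rewrite coef1.
  - by rewrite coef1 gtn_eqF // vge0.
  - by rewrite coef1 gtn_eqF.
  - rewrite ltnS leqn0 => /eqP->; rewrite coef_frob mulr1 d0 coef1 eqxx expr1n //.
have [|//|c [c0 ck cn h]] := IH; first exact: ltnW.
have y1 : vge vC 1 (d * c)`_n.+1.
  rewrite coefM; apply: vge_sum => i _; rewrite -[1]addr0.
  have [->|i0] := posnP i; first by rewrite d0 mul1r addr0 subn0 cn // vge0.
  apply: vgeM; first by apply: dk; rewrite i0 (leq_ltn_trans _ nN) // -ltnS.
  have [E|e0] := posnP (n.+1 - i)%N; first by rewrite E c0.
  by apply: vge_le (ck _ e0).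
have [x x1 hx] := complete_artin_schreier Ccomplete charC y1.
exists (c + x *: 'X^(n.+1)); split.
- by rewrite coefD coefZ coefXn mulr0 addr0.
- by move=> k k0; rewrite coefD coefZ coefXn; apply: vgeD; [exact: ck|case: eqP => _; rewrite ?mulr1 ?mulr0 ?vge0].
- by move=> k kn; rewrite coefD coefZ coefXn gtn_eqF // mulr0 addr0 cn // ltnW.
- by apply: lang_solution_step => //; exact: cn.
Qed.

(** For [A'] near [A], the quotient [A' / A] is so close to 1 that it equals [frob c / c] with [c]
    over [C]. Then [b * c] solves the equation of [A'], and its cocycle is that of [b] because [c]
    is Galois invariant. *)
Lemma local_lang_solution : exists (A : {poly C}) (M : int), A`_0 = 1 /\
  forall A' : {poly C}, A'`_0 = 1 -> (forall k, (k < N)%N -> vge vC M (A'`_k - A`_k)) ->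
  exists2 b : {poly L}, lang_solution charL N (map_poly (in_alg L) A') b &
    forall s : gal_of {:L}, eqX N (map_poly s b) (b * (1 + 'X) ^+ chi s).
Proof.
have [b b0 bs] := character_lang.
have [A A0 [_ hA]] := local_lang_generator b0 bs.
have [J J0 AJ] := eqX_inv N A0.
(* [- B] bounds from below the values of the coefficients of the inverse [J] of [A]. With precision
   [B + 1], the coefficients of [(A' - A) * J] have value at least 1. *)
pose B := (\sum_(k < size J) absz (vC (J`_k)%R))%N.
have BP k : vge vC (- B%:Z) J`_k.
  have [kI|kI] := ltnP k (size J); last by rewrite nth_default ?vge0.
  apply: vge_le (vge_val _ _); rewrite /B (bigD1 (Ordinal kI)) //=; lia.
exists A, (B%:Z + 1); split=> // A' A'0 A'A.
pose d := A' * J.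
have d0 : d`_0 = 1 by rewrite /d coefM big_ord1 subnn A'0 J0 mulr1.
have [|c [c0 hc]] := small_lang_solution d0.
  move=> k /andP[k0 kN].
  have -> : d`_k = ((A' - A) * J)`_k.
    by rewrite /d mulrBl coefB (AJ k kN) coef1 gtn_eqF // subr0.
  rewrite coefM; apply: vge_sum => i _; have iN : (i < N)%N by apply: leq_ltn_trans kN; rewrite -ltnS.
  have := vgeM (A'A i iN) (BP (k - i)%N).
  by rewrite coefB addrAC subrr add0r.
have hc' : eqX N (frob charC c * A) (A' * c).
  apply: eqX_trans (eqXMr _ hc) _.
  have -> : d * c * A = (A * J) * (A' * c) by rewrite /d; ring.
  by rewrite -[X in eqX _ _ X]mul1r; apply: eqXMr.
exists (b * map_poly (in_alg L) c).
  split; first by rewrite coefM big_ord1 subnn b0 coef_map c0 mul1r /= scale1r.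
  rewrite frobM (frob_map charC); apply: eqX_trans (eqXMr _ hA) _.
  rewrite [X in eqX _ X _]mulrAC [X in eqX _ _ X]mulrCA [X in eqX _ _ X]mulrC -!rmorphM.
  by apply: eqXMr; apply: eqX_map; rewrite [X in eqX _ X _]mulrC.
move=> s; rewrite rmorphM /= mulrAC.
have -> : map_poly s (map_poly (in_alg L) c) = map_poly (in_alg L) c.
  by rewrite -map_poly_comp; apply: eq_map_poly => x; exact: gal_base.
exact: eqXMr.
Qed.

End LocalLang.

(** * Galois embeddings and characters of Lang's equation *)

Lemma alg_lrmorphism (K : fieldType) (L M : fieldExtType K) (f : {rmorphism L -> M}) :
  (forall a, f a%:A = a%:A) -> exists g : {lrmorphism L -> M}, forall x, g x = f x.
Proof.
move=> fK.
have fZ : scalable f by move=> a x; rewrite -[a *: x]mulr_algl rmorphM fK mulr_algl.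
pose h : L -> M := f; have hB : zmod_morphism h := rmorphB f.
have hM : monoid_morphism h by split; [exact: rmorph1 | exact: rmorphM].
pose g : {lrmorphism L -> M} := HB.pack h (GRing.isZmodMorphism.Build L M h hB)
  (GRing.isMonoidMorphism.Build L M h hM) (GRing.isScalable.Build K L M *:%R h fZ).
by exists g.
Qed.

Lemma alg_horner (K : fieldType) (L M : fieldExtType K) (f : {rmorphism L -> M}) :
  (forall a, f a%:A = a%:A) -> forall (P : {poly K}) z,
  f (map_poly (in_alg L) P).[z] = (map_poly (in_alg M) P).[f z].
Proof.
move=> fK P z; rewrite -horner_map /= -map_poly_comp; congr (_.[_]).
by apply: eq_map_poly => a; exact: fK.
Qed.

Lemma gal_horner (K : fieldType) (L : splittingFieldType K) (s : gal_of {:L}) (P : {poly K}) z :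
  s (map_poly (in_alg L) P).[z] = (map_poly (in_alg L) P).[s z].
Proof. exact: (alg_horner (gal_base s)). Qed.

Lemma factor_morphism (A L M : fieldType) (f : {rmorphism A -> M}) (l : {rmorphism L -> M}) :
  (forall x, exists y, f x = l y) -> exists g : {rmorphism A -> L}, forall x, l (g x) = f x.
Proof.
move=> h; have [g gE] := choice h.
have gB : zmod_morphism g by move=> x y; apply: (fmorph_inj l); rewrite rmorphB -!gE rmorphB.
have gM : monoid_morphism g.
  by split=> [|x y]; apply: (fmorph_inj l); rewrite ?rmorphM ?rmorph1 -?gE ?rmorphM ?rmorph1.
pose gA := GRing.isZmodMorphism.Build A L g gB.
pose gR := GRing.isMonoidMorphism.Build A L g gM.
pose g' : {rmorphism A -> L} := HB.pack g gA gR.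
by exists g' => x; rewrite gE.
Qed.

Section GaloisEmbeddings.
Variables (K : fieldType) (L : splittingFieldType K).
Hypothesis galL : galois 1 {:L}.

(** [g z] is a root of the image under [f] of the minimal polynomial of a primitive element [z], and
    these roots are the [f (t z)] by normality. *)
Lemma embeddings_conjugate (B : fieldType) (f g : {rmorphism L -> B}) :
  (forall a, f a%:A = g a%:A) -> exists t : gal_of {:L}, forall x, g x = f (t x).
Proof.
move=> fg; have [z zgen] := galois_primitive galL.
have [h hm hE] := minPoly1P z; have [r rE] := galois_splits hE.
have mapE (P : {poly K}) : map_poly f (map_poly (in_alg L) P) = map_poly g (map_poly (in_alg L) P).
  by rewrite -!map_poly_comp; apply: eq_map_poly => a /=; exact: fg.
have : root (map_poly f (map_poly (in_alg L) h)) (g z).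
  by rewrite mapE fmorph_root hE root_minPoly.
rewrite rE rmorph_prod (eq_bigr (fun s : gal_of {:L} => 'X - (f (s z))%:P)); last first.
  by move=> s _; rewrite /= map_polyXsubC.
rewrite -(big_map (fun s : gal_of {:L} => f (s z)) xpredT (fun y => 'X - y%:P)).
rewrite root_prod_XsubC => /mapP[t _ gz].
exists t => x; have [P [_ ->]] := adjoin1_full_poly x zgen.
by rewrite gal_horner -!horner_map /= -mapE gz.
Qed.

Variable M : splittingFieldType K.
Hypothesis galM : galois 1 {:M}.
Variable l : {rmorphism L -> M}.
Hypothesis lK : forall a, l a%:A = a%:A.

Lemma gal_extend (s : gal_of {:L}) : exists t : gal_of {:M}, forall x, t (l x) = l (s x).
Proof.
have [z zgen] := galois_primitive galL; have [h hm hE] := minPoly1P z.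
have mapE (P : {poly K}) : map_poly l (map_poly (in_alg L) P) = map_poly (in_alg M) P.
  by rewrite -map_poly_comp; apply: eq_map_poly => a /=; exact: lK.
have [g gE] := alg_lrmorphism lK.
have minl x : map_poly l (minPoly 1 x) = minPoly 1 (l x).
  have := map_minPoly (linfun g) 1%AS x; rewrite aimg1 lfunE /= gE => <-.
  by apply: eq_map_poly => y; rewrite lfunE /= gE.
have : root (minPoly 1 (l z)) (l (s z)).
  rewrite -minl fmorph_root -hE.
  have -> : map_poly (in_alg L) h = map_poly s (map_poly (in_alg L) h).
    by rewrite -map_poly_comp; apply: eq_map_poly => a /=; rewrite gal_base.
  by rewrite fmorph_root hE root_minPoly.
move=> /(normalField_root_minPoly (sub1v _) (normalFieldf _) (memvf _))[t _ tz].
exists t => x; have [P [_ ->]] := adjoin1_full_poly x zgen.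
by rewrite (alg_horner lK) gal_horner tz gal_horner (alg_horner lK).
Qed.

Lemma fixed_image (y : M) :
  (forall t : gal_of {:M}, (forall x, t (l x) = l x) -> t y = y) -> exists x, y = l x.
Proof.
move=> h; have [g gE] := alg_lrmorphism lK.
pose A : {subfield M} := (linfun g @: {:L})%AS.
have galA : galois A {:M} by apply: (galoisS _ galM); rewrite sub1v subvf.
have /galois_fixedField fixE := galA.
have : y \in fixedField 'Gal({:M} / A)%g.
  apply/fixedFieldP => [|t tA]; first exact: memvf.
  apply: h => x; apply: (fixed_gal (subvf A) tA).
  by rewrite -gE -[g x]lfunE memv_img ?memvf.
by rewrite fixE => /memv_imgP[x _ ->]; exists x; rewrite lfunE /= gE.
Qed.

End GaloisEmbeddings.

Section LangCharacter.
Variables (p a : nat) (K : fieldType) (Om : splittingFieldType K).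
Hypothesis charOm : p \in [pchar Om].
Variables (A : {poly K}) (b : {poly Om}).
Hypothesis hb : lang_solution charOm (p ^ a) (map_poly (in_alg Om) A) b.
Local Notation N := (p ^ a)%N.
Local Notation Fp := (Fp_to charOm).

Let p_pr := pcharf_prime charOm.
Let N0 : (0 < N)%N. Proof. by rewrite expn_gt0 prime_gt0. Qed.

Lemma gal_Fp (s : gal_of {:Om}) f : map_poly s (map_poly Fp f) = map_poly Fp f.
Proof. exact: (Fp_to_map charOm charOm). Qed.

Lemma lang_cocycle (s : gal_of {:Om}) :
  exists2 f : {poly 'F_p}, f`_0 = 1 & eqX N (map_poly s b) (b * map_poly Fp f).
Proof.
apply: (lang_solution_ratio N0 hb).
have := lang_solution_map charOm s hb.
have -> // : map_poly s (map_poly (in_alg Om) A) = map_poly (in_alg Om) A.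
by rewrite -map_poly_comp; apply: eq_map_poly => x; exact: gal_base.
Qed.

(** Automorphisms fix the coefficients of the cocycle, which lie in F_p, so the cocycle is a
    homomorphism to U(F_p); [rho] turns it into a character. The second clause is what later
    identifies this character with a local one. *)
Lemma lang_character : exists chi : gal_of {:Om} -> nat,
  (forall s t : gal_of {:Om}, chi (s * t)%g = chi s + chi t %[mod N]) /\
  (forall (s : gal_of {:Om}) k, eqX N (map_poly s b) (b * (1 + 'X) ^+ k) -> chi s = k %[mod N]).
Proof.
have H (s : gal_of {:Om}) : exists f : {poly 'F_p},
    f`_0 = 1 /\ eqX N (map_poly s b) (b * map_poly Fp f).
  by have [f] := lang_cocycle s; exists f.
have [f fP] := choice H; have [rho [rhoM rhoE rhoX]] := unipotent_retraction a p_pr.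
have [b0 _] := hb.
have uniq (g1 g2 : {poly 'F_p}) : eqX N (b * map_poly Fp g1) (b * map_poly Fp g2) -> eqX N g1 g2.
  by move=> /(eqX_cancel b0); exact: eqX_map_inj.
exists (fun s => rho (f s)); split=> [s t|s k].
  have [fs0 fs] := fP s; have [ft0 ft] := fP t; have [fst0 fst] := fP (s * t)%g.
  rewrite -rhoM //; congr (_ %% _)%N; apply: rhoE => //.
    by rewrite coefM big_ord1 subnn fs0 ft0 mulr1.
  apply: uniq; apply: eqX_trans (eqX_sym fst) _; rewrite galM_map.
  apply: eqX_trans (eqX_map (gal_repr t : {rmorphism Om -> Om}) fs) _.
  rewrite rmorphM /= gal_Fp [X in eqX _ _ (_ * X)]rmorphM /=.
  by rewrite [map_poly Fp (f s) * _]mulrC mulrA; apply: eqXMr.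
move=> hk; have [fs0 fs] := fP s; rewrite -[RHS]rhoX; congr (_ %% _)%N; apply: rhoE => //.
  by rewrite -horner_coef0 horner_exp !hornerE ?addr0 expr1n.
apply: uniq; apply: eqX_trans (eqX_sym fs) _.
by rewrite map_Fp_to_X1.
Qed.

End LangCharacter.

Section GaloisAdjoinLang.
Variables (p : nat) (K : fieldType).
Hypothesis charK : p \in [pchar K].

Lemma galois_adjoin_lang (Om : splittingFieldType K) (A : {poly K}) n :
  galois 1 {:Om} -> A`_0 = 1 ->
  exists (Om2 : splittingFieldType K) (j : {rmorphism Om -> Om2}) (c2 : p \in [pchar Om2]) (b : {poly Om2}),
    [/\ galois 1 {:Om2}, forall x, j x%:A = x%:A &
        lang_solution c2 n (map_poly (in_alg Om2) A) b].
Proof.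
move=> galOm A0; have charE (L : fieldExtType K) : p \in [pchar L] by exact: (pchar_ext (in_alg L) charK).
(* The induction runs at precision [n.+1], solved by [b = 1] for [n = 0]. Keeping all further
   coefficients zero leaves the next one free to be chosen. *)
suff [Om2 [j [c2 [b [g jK h _]]]]] : exists (Om2 : splittingFieldType K) (j : {rmorphism Om -> Om2})
    (c2 : p \in [pchar Om2]) (b : {poly Om2}),
    [/\ galois 1 {:Om2}, forall x, j x%:A = x%:A,
        lang_solution c2 n.+1 (map_poly (in_alg Om2) A) b & forall k, (n.+1 <= k)%N -> b`_k = 0].
  exists Om2, j, c2, b; split=> //; have [b0 hb] := h; split=> // k kn; apply: hb; exact: ltnW.
elim: n => [|n [Om1 [j1 [c1 [b1 [g1 j1K [b10 h1] z1]]]]]].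
  exists Om, [the {rmorphism Om -> Om} of idfun], (charE Om), 1; split=> //.
    split=> [|k]; first by rewrite coef1.
    by rewrite ltnS leqn0 => /eqP->; rewrite coef_frob mulr1 coef1 coef_map /= A0 expr1n scale1r.
  by move=> k k0; rewrite coef1 gtn_eqF.
have [Om2 [j [g2 jK [x hx]]]] := galois_adjoin_artin_schreier g1 (map_poly (in_alg Om1) A * b1)`_n.+1 charK.
exists Om2, [the {rmorphism Om -> Om2} of j \o j1], (charE Om2), (map_poly j b1 + x *: 'X^(n.+1)).
have mA : map_poly j (map_poly (in_alg Om1) A) = map_poly (in_alg Om2) A.
  by rewrite -map_poly_comp; apply: eq_map_poly => y; exact: jK.
split=> //.
- by move=> y /=; rewrite j1K jK.
- split; first by rewrite coefD coefZ coefXn mulr0 addr0 coef_map /= b10 rmorph1.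
  apply: lang_solution_step.
  + by rewrite coef_map /= A0 scale1r.
  + by rewrite (frob_map c1) -mA -rmorphM; exact: eqX_map.
  + by rewrite coef_map /= z1 // rmorph0.
  + by rewrite hx -coef_map rmorphM /= mA.
- by move=> k kn; rewrite coefD coefZ coefXn gtn_eqF // mulr0 addr0 coef_map /= z1 ?rmorph0 // ltnW.
Qed.

Lemma galois_adjoin_langs (F : splittingFieldType K) (A : nat -> {poly K}) (N : nat -> nat) s :
  galois 1 {:F} -> (forall i, (A i)`_0 = 1) ->
  exists (Om : splittingFieldType K) (j : {rmorphism F -> Om}) (c : p \in [pchar Om]),
    [/\ galois 1 {:Om}, forall x, j x%:A = x%:A &
      forall i, (i < s)%N -> exists b, lang_solution c (N i) (map_poly (in_alg Om) (A i)) b].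
Proof.
move=> galF A0; elim: s => [|s [Om [j [c [g jK h]]]]].
  exists F, [the {rmorphism F -> F} of idfun].
  by exists (pchar_ext (in_alg F) charK).
have [Om2 [j2 [c2 [b [g2 j2K hb]]]]] := galois_adjoin_lang (N s) g (A0 s).
exists Om2, [the {rmorphism F -> Om2} of j2 \o j], c2; split=> //.
  by move=> x /=; rewrite jK j2K.
move=> i; rewrite ltnS leq_eqVlt => /orP[/eqP->|/h[b1 h1]]; first by exists b.
exists (map_poly j2 b1); have := lang_solution_map c2 j2 h1.
by rewrite -map_poly_comp (eq_map_poly (g := in_alg Om2)) // => x; exact: j2K.
Qed.

End GaloisAdjoinLang.

(** * From local to global extensions *)

Lemma mem_gal1 (K : fieldType) (L : splittingFieldType K) (s : gal_of {:L}) :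
  s \in 'Gal({:L} / 1)%g.
Proof. by rewrite gal_kHom ?sub1v // k1AHom. Qed.

(** In a finite group, closure under products gives a subgroup and closure under conjugation makes
    it normal. [E] is its fixed field, and the last clause is the Galois correspondence. *)
Lemma fixed_subfield (K : fieldType) (Om : splittingFieldType K) (P : gal_of {:Om} -> Prop) :
  galois 1 {:Om} -> P 1%g -> (forall s t, P s -> P t -> P (s * t)%g) ->
  (forall s t, P s -> P (s ^ t)%g) ->
  exists (E : splittingFieldType K) (i : {lrmorphism E -> Om}),
    [/\ galois 1 {:E}, forall y, (forall t, P t -> t y = y) -> exists x, y = i x,
        forall t x, P t -> t (i x) = i x
      & forall t : gal_of {:Om}, (forall x, t (i x) = i x) -> P t].
Proof.
move=> galOm P1 PM PJ; pose H := [set t : gal_of {:Om} | `[< P t >]]%SET.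
have HE t : (t \in H) <-> P t by rewrite inE; split=> /asboolP.
have gH : group_set H.
  by apply/group_setP; split=> [|s t /HE Ps /HE Pt]; apply/HE => //; exact: PM.
pose G := Group gH.
have nG : (G <| 'Gal({:Om} / 1))%g.
  apply/andP; split; first by apply/fintype.subsetP => t _; exact: mem_gal1.
  apply/fintype.subsetP => t _; rewrite inE; apply/fintype.subsetP => x.
  rewrite mem_conjg => /HE Px; apply/HE.
  by rewrite -(conjgKV t x); exact: PJ.
have galE := normal_fixedField_galois galOm nG.
have nE : normalField 1 (fixedField G) by case/and3P: galE.
have [E [i [gE iP]]] := subfield_splitting galOm nE.
exists E, i; split=> //.
- by move=> y hy; apply/iP/fixedFieldP => [|t /HE Pt]; [exact: memvf | exact: hy].
- move=> t x Pt; have : i x \in fixedField G by apply/iP; exists x.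
  by move=> /mem_fixedFieldP[_]; apply; apply/HE.
- move=> t ht; apply/HE; change (t \in G); rewrite -(gal_fixedField G).
  rewrite gal_kHom ?subvf //; apply/kAHomP => y /iP[x ->]; exact: ht.
Qed.

Definition base_emb (K : fieldType) (u : place K) (Ku : completion u) (L : fieldExtType Ku) :
  {rmorphism K -> L} := [the {rmorphism K -> L} of in_alg L \o cpl_emb Ku].

Lemma vge_emb (K : fieldType) (u : place K) (Ku : completion u) N x :
  vge (cpl_val Ku) N (cpl_emb Ku x) = vge u N x.
Proof. by have [h _ _] := cpl_isP Ku; rewrite /vge fmorph_eq0 h. Qed.

(** Each local equation tolerates a small change of its coefficients, so one polynomial over [K]
    close to all of them serves at every place. *)
Lemma global_lang_approx (p a : nat) (K : fieldType) (r : nat) (u : 'I_r -> place K)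
    (Ku : forall i, completion (u i)) (L : forall i, splittingFieldType (Ku i))
    (chi : forall i, gal_of {:L i} -> nat) :
  p \in [pchar K] -> injective u -> (forall i, galois 1 {:L i}) ->
  (forall i s t, chi i (s * t)%g = chi i s + chi i t %[mod p ^ a]) ->
  exists2 A : {poly K}, A`_0 = 1 & forall i (cL : p \in [pchar (L i)]),
    exists2 b : {poly L i}, lang_solution cL (p ^ a) (map_poly (base_emb (L i)) A) b &
    forall s : gal_of {:L i}, eqX (p ^ a) (map_poly s b) (b * (1 + 'X) ^+ chi i s).
Proof.
move=> charK uI galL chiM.
have cC i : p \in [pchar (Ku i)] := pchar_ext (cpl_emb (Ku i)) charK.
have cL0 i : p \in [pchar (L i)] := pchar_ext (base_emb (L i)) charK.
have cpl i (x : nat -> Ku i) : vcauchy (cpl_val (Ku i)) x -> exists l, vconverges (cpl_val (Ku i)) x l.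
  by have [_ h _] := cpl_isP (Ku i); exact: h.
have loc i := local_lang_solution (cC i) (cL0 i) (cpl i) (galL i) (chiM i).
pose Al i := projT1 (cid (loc i)); have loc2 i := projT2 (cid (loc i)).
pose Ml i := projT1 (cid (loc2 i)); have loc3 i := projT2 (cid (loc2 i)).
(* The constant coefficient must be exactly 1, not merely close to it, so it is treated apart. *)
have H k : exists x : K, (k = 0%N -> x = 1) /\
    forall i, vge (cpl_val (Ku i)) (Ml i) (cpl_emb (Ku i) x - (Al i)`_k).
  case: k => [|k].
    by exists 1; split=> // i; have [A0 _] := loc3 i; rewrite rmorph1 A0 subrr vge0.
  have D i : exists x : K, vge (cpl_val (Ku i)) (Ml i) (cpl_emb (Ku i) x - (Al i)`_k.+1).
    have [_ _ /(_ (Al i)`_k.+1 (Ml i))[x]] := cpl_isP (Ku i).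
    by rewrite vcloseE; exists x.
  have [x xP] := choice D; have [y yP] := weak_approximation x Ml uI.
  exists y; split=> // i; apply: vge_trans (xP i).
  by rewrite -rmorphB vge_emb.
have [x xP] := choice H.
exists (\poly_(k < (p ^ a).+1) x k); first by rewrite coef_poly /=; have [->] := xP 0%N.
move=> i cL; have [_ h] := loc3 i.
have [||b [b0 hb] bs] := h (map_poly (cpl_emb (Ku i)) (\poly_(k < (p ^ a).+1) x k)).
- by rewrite coef_map coef_poly /=; have [->] := xP 0%N; rewrite ?rmorph1.
- move=> k kN; rewrite coef_map coef_poly ltnS ltnW //.
  by have [_] := xP k; apply.
- exists b => //; split=> //; rewrite (_ : cL = cL0 i); last exact: bool_irrelevance.
  apply: eqX_trans hb _; rewrite -map_poly_comp; exact: eqX_refl.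
Qed.

(** * The global field and its local embeddings *)

Section GlobalExtension.
Variables (p : nat) (K : fieldType) (F : splittingFieldType K) (s : nat) (a : nat -> nat)
  (r : nat) (u : 'I_r -> place K) (Ku : forall i, completion (u i))
  (L : forall i, splittingFieldType (Ku i)) (chi : forall i, nat -> gal_of {:L i} -> nat)
  (mu : forall i, {rmorphism F -> L i}).
Hypotheses (charK : p \in [pchar K]) (galF : galois 1 {:F}) (abF : abelian 'Gal({:F} / 1)%g)
  (uI : injective u) (galL : forall i, galois 1 {:L i})
  (chiM : forall i k x y, chi k (x * y)%g = chi (i := i) k x + chi k y %[mod p ^ a k])
  (chi_inj : forall i (x : gal_of {:L i}),
     (forall k, (k < s)%N -> chi k x = 0 %[mod p ^ a k]) -> x = 1%g)
  (muK : forall i x, mu i x%:A = base_emb (L i) x).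

(** [M] is Galois over the completion and contains [L i] and an image of [Om]. An automorphism of
    [M] has the same characters whether restricted to [L i] or to [Om]. If it fixes [L i], it
    satisfies the condition defining [E], so [E] lands in [L i]. Conversely, an automorphism of
    [L i] fixing [E] has trivial characters, hence is 1. *)
Lemma local_descent (Om : splittingFieldType K) (jF : {rmorphism F -> Om}) (cO : p \in [pchar Om])
    (A : nat -> {poly K}) (b : nat -> {poly Om}) (X : nat -> gal_of {:Om} -> nat)
    (E : splittingFieldType K) (iE : {lrmorphism E -> Om}) i (bl : nat -> {poly L i})
    (cL : p \in [pchar (L i)]) :
  galois 1 {:Om} -> (forall x, jF x%:A = x%:A) ->
  (forall k, (k < s)%N -> lang_solution cO (p ^ a k) (map_poly (in_alg Om) (A k)) (b k)) ->
  (forall k, lang_solution cL (p ^ a k) (map_poly (base_emb (L i)) (A k)) (bl k)) ->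
  (forall k (x : gal_of {:L i}), eqX (p ^ a k) (map_poly x (bl k)) (bl k * (1 + 'X) ^+ chi k x)) ->
  (forall k (t : gal_of {:Om}) n, (k < s)%N ->
     eqX (p ^ a k) (map_poly t (b k)) (b k * (1 + 'X) ^+ n) -> X k t = n %[mod p ^ a k]) ->
  (forall (t : gal_of {:Om}) x, (forall x, t (jF x) = jF x) /\ (forall k, (k < s)%N -> X k t = 0 %[mod p ^ a k]) ->
     t (iE x) = iE x) ->
  (forall t : gal_of {:Om}, (forall x, t (iE x) = iE x) ->
     (forall x, t (jF x) = jF x) /\ (forall k, (k < s)%N -> X k t = 0 %[mod p ^ a k])) ->
  exists psi : {rmorphism E -> L i}, (forall x, psi x%:A = base_emb (L i) x) /\
    forall x : gal_of {:L i}, (forall y, x (psi y) = psi y) -> x = 1%g.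
Proof.
move=> galOm jFK bP blP blX XP fixE Efix.
have [z zgen] := galois_primitive galOm; have [h hm hE] := minPoly1P z.
have sh : separable_poly (map_poly (cpl_emb (Ku i)) h).
  rewrite separable_map -(separable_map (in_alg Om)) hE.
  by have /and3P[_ /separableP sep _] := galOm; exact: (sep z (memvf _)).
have [M [l [galM lK [rs rsE]]]] := galois_adjoin_split (galL i) sh.
pose kM := base_emb M; have cM : p \in [pchar M] := pchar_ext kM charK.
have lB x : l (base_emb (L i) x) = kM x by rewrite /= lK.
have hMe : map_poly (in_alg M) (map_poly (cpl_emb (Ku i)) h) = map_poly kM h.
  by rewrite -map_poly_comp.
have [||zB hzB] := @dvdp_split_root _ (map_poly kM h) rs.
- by rewrite -(eqp_dvdr _ rsE) hMe dvdpp.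
- by rewrite size_map_poly -(size_map_poly (in_alg Om)) hE size_minPoly.
have [psi [psiK _]] := adjoin1_morphism zgen hE hzB.
have kM_gal (t : gal_of {:M}) x : t (kM x) = kM x by exact: gal_base.
(* The images in [M] of [b k] and [bl k] solve one equation, so they differ by a factor over F_p;
   the cocycle of [bl k] is therefore also that of [b k]. *)
have compat (t : gal_of {:M}) (x : gal_of {:L i}) (y : gal_of {:Om}) :
    (forall w, t (l w) = l (x w)) -> (forall w, t (psi w) = psi (y w)) ->
    forall k, (k < s)%N -> X k y = chi k x %[mod p ^ a k].
  move=> tx ty k ks; apply: XP => //; apply: (eqX_map_inj (j := psi)).
  have N0 : (0 < p ^ a k)%N by rewrite expn_gt0 prime_gt0 // (pcharf_prime charK).
  have mapl : map_poly l (map_poly (base_emb (L i)) (A k)) = map_poly kM (A k).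
    by rewrite -map_poly_comp; apply: eq_map_poly => w; exact: lB.
  have mapp : map_poly psi (map_poly (in_alg Om) (A k)) = map_poly kM (A k).
    by rewrite -map_poly_comp; apply: eq_map_poly => w; exact: psiK.
  have s1 := lang_solution_map cM psi (bP k ks); rewrite mapp in s1.
  have s2 := lang_solution_map cM l (blP k); rewrite mapl in s2.
  have [f f0 fE] := lang_solution_ratio N0 s2 s1.
  have -> : map_poly psi (map_poly y (b k)) = map_poly t (map_poly psi (b k)).
    by rewrite -!map_poly_comp; apply: eq_map_poly => w /=; rewrite ty.
  apply: eqX_trans (eqX_map t fE) _; rewrite rmorphM /= gal_Fp.
  have -> : map_poly t (map_poly l (bl k)) = map_poly l (map_poly x (bl k)).
    by rewrite -!map_poly_comp; apply: eq_map_poly => w /=; rewrite tx.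
  apply: eqX_trans (eqXMr _ (eqX_map l (blX k x))) _.
  rewrite !rmorphM !rmorphXn !rmorphD !rmorph1 /= !map_polyX mulrAC.
  by apply: eqXMr; apply: eqX_sym.
have chi1 k : chi (i := i) k 1%g = 0 %[mod p ^ a k].
  have := chiM k (1%g : gal_of {:L i}) 1%g; rewrite mulg1 -{1}[chi k 1%g]addn0 => /eqP.
  by rewrite eqn_modDl => /eqP.
have restr (t : gal_of {:M}) : exists y : gal_of {:Om}, forall w, t (psi w) = psi (y w).
  have [|y yE] := embeddings_conjugate galOm (f := psi) (g := [the {rmorphism Om -> M} of t \o psi]).
    by move=> w; rewrite /= psiK kM_gal.
  by exists y.
(* The embeddings of [F] in [M] through [L i] and through [Om] may differ, but only by an
   automorphism of [F]; so fixing one image amounts to fixing the other. *)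
have [|tF tFE] := embeddings_conjugate galF (f := [the {rmorphism F -> M} of l \o mu i])
    (g := [the {rmorphism F -> M} of psi \o jF]).
  by move=> w; rewrite /= muK lB jFK psiK.
have lands x : exists y, psi (iE x) = l y.
  apply: (fixed_image galM lK) => t tl; have [y yE] := restr t.
  rewrite yE fixE //; split=> [w|k ks].
    by apply: (fmorph_inj psi); rewrite -yE; have /= := tFE w => ->; rewrite tl.
  by rewrite (compat t 1%g y _ yE k ks) // => w; rewrite gal_id tl.
have [psiE psiEP] := factor_morphism (f := [the {rmorphism E -> M} of psi \o iE]) lands.
exists psiE; split=> [x|x xfix].
  by apply: (fmorph_inj l); rewrite psiEP /= lK linearZ rmorph1 psiK.
have [t tE] := gal_extend (galL i) lK x.
have [y yE] := restr t.
have [_ Xy] : (forall w, y (jF w) = jF w) /\ (forall k, (k < s)%N -> X k y = 0 %[mod p ^ a k]).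
  apply: Efix => w; apply: (fmorph_inj psi); rewrite -yE.
  by have /= := psiEP w => <-; rewrite tE xfix.
by apply: chi_inj => k ks; rewrite -(compat t x y tE yE k ks) Xy.
Qed.

Lemma global_extension :
  exists (E : splittingFieldType K) (iota : {lrmorphism F -> E}) (X : nat -> gal_of {:E} -> nat),
  [/\ galois 1 {:E}, abelian 'Gal({:E} / 1)%g,
      forall k (x y : gal_of {:E}), (k < s)%N -> X k (x * y)%g = X k x + X k y %[mod p ^ a k],
      forall x : gal_of {:E}, (forall y, x (iota y) = iota y) ->
        (forall k, (k < s)%N -> X k x = 0 %[mod p ^ a k]) -> x = 1%g
    & forall i, exists psi : {rmorphism E -> L i}, (forall x, psi x%:A = base_emb (L i) x) /\
        forall x : gal_of {:L i}, (forall y, x (psi y) = psi y) -> x = 1%g].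
Proof.
have H1 k : exists A : {poly K}, A`_0 = 1 /\ forall i (cL : p \in [pchar (L i)]),
    exists2 b : {poly L i}, lang_solution cL (p ^ a k) (map_poly (base_emb (L i)) A) b &
    forall x : gal_of {:L i}, eqX (p ^ a k) (map_poly x b) (b * (1 + 'X) ^+ chi k x).
  have [A A0 AP] := global_lang_approx (chi := fun i => chi (i := i) k) charK uI galL (fun i => @chiM i k).
  by exists A.
have [A AP] := choice H1.
have [Om [jF [cO [galOm jFK langs]]]] :=
  galois_adjoin_langs charK (fun k => p ^ a k)%N s galF (fun k => (AP k).1).
have H2 k : exists b : {poly Om}, (k < s)%N ->
    lang_solution cO (p ^ a k) (map_poly (in_alg Om) (A k)) b.
  have [ks|ks] := ltnP k s; last by exists 0.
  by have [b hb] := langs k ks; exists b.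
have [b bP] := choice H2.
have H3 k : exists X : gal_of {:Om} -> nat, (k < s)%N ->
    (forall x y : gal_of {:Om}, X (x * y)%g = X x + X y %[mod p ^ a k]) /\
    (forall (x : gal_of {:Om}) n, eqX (p ^ a k) (map_poly x (b k)) (b k * (1 + 'X) ^+ n) ->
      X x = n %[mod p ^ a k]).
  have [ks|ks] := ltnP k s; last by exists (fun=> 0%N).
  by have [X XP] := lang_character (bP k ks); exists X.
have [X XP] := choice H3.
pose P (t : gal_of {:Om}) := (forall x, t (jF x) = jF x) /\
  (forall k, (k < s)%N -> X k t = 0 %[mod p ^ a k]).
have XM k (x y : gal_of {:Om}) : (k < s)%N -> X k (x * y)%g = X k x + X k y %[mod p ^ a k].
  by move=> ks; have [h _] := XP k ks; exact: h.
have X1 k : (k < s)%N -> X k 1%g = 0 %[mod p ^ a k].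
  move=> ks; have := XM k 1%g 1%g ks; rewrite mulg1 -{1}[X k 1%g]addn0 => /eqP.
  by rewrite eqn_modDl => /eqP.
have Xadd0 k x y : (k < s)%N -> X k x = 0 %[mod p ^ a k] -> X k (x * y)%g = X k y %[mod p ^ a k].
  by move=> ks h; rewrite XM // -modnDml h mod0n add0n.
have restrF (t : gal_of {:Om}) : exists t' : gal_of {:F}, forall x, t (jF x) = jF (t' x).
  have [|t' tE] := embeddings_conjugate galF (f := jF) (g := [the {rmorphism F -> Om} of t \o jF]).
    by move=> x; rewrite /= jFK gal_base.
  by exists t'.
have P1 : P 1%g by split=> [x|k ks]; [rewrite gal_id | exact: X1].
have PM x y : P x -> P y -> P (x * y)%g.
  move=> [x1 x2] [y1 y2]; split=> [w|k ks]; first by rewrite galM_full x1 y1.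
  by rewrite Xadd0 ?x2 ?y2.
have PJ x y : P x -> P (x ^ y)%g.
  move=> [x1 x2]; split=> [w|k ks].
    rewrite conjgE !galM_full; have [t' tE] := restrF y^-1%g.
    by rewrite tE x1 -tE -galM_full mulVg gal_id.
  rewrite conjgE XM // -modnDmr Xadd0 ?x2 // modnDmr -XM // mulVg; exact: X1.
have [E [iE [galE Eim Efix Einv]]] := fixed_subfield galOm P1 PM PJ.
have iEI x y : iE x = iE y -> x = y by exact: fmorph_inj.
have iEK (x : K) : iE x%:A = x%:A by rewrite linearZ rmorph1.
have [iota0 iota0P] : exists g : {rmorphism F -> E}, forall x, iE (g x) = jF x.
  by apply: factor_morphism => x; apply: Eim => t [t1 _].
have [x|iota iotaP] := alg_lrmorphism (f := iota0).
  by apply: iEI; rewrite iota0P jFK iEK.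
have ext (x : gal_of {:E}) : exists t : gal_of {:Om}, forall w, t (iE w) = iE (x w).
  exact: (gal_extend galE iEK).
have [e eP] := choice ext.
have same (x y : gal_of {:Om}) : (forall w, x (iE w) = y (iE w)) -> P (x * y^-1)%g.
  move=> xy; apply: Einv => w; rewrite galM_full xy.
  by rewrite -galM_full mulgV gal_id.
have sameX k (x y : gal_of {:Om}) : (k < s)%N -> (forall w, x (iE w) = y (iE w)) ->
    X k x = X k y %[mod p ^ a k].
  move=> ks /same[_ /(_ k ks) h].
  have -> : (x = x * y^-1 * y)%g by rewrite mulgVK.
  by rewrite Xadd0.
have cF (x y : gal_of {:F}) : (x * y = y * x)%g.
  by apply: (centsP abF); exact: mem_gal1.
(* A commutator acts trivially on [F], whose group is abelian, and has trivial characters; hence it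
   satisfies [P] and fixes [E]. *)
have cOm (x y : gal_of {:Om}) w : (x * y)%g (iE w) = (y * x)%g (iE w).
  have Pn : P ((x * y) * (y * x)^-1)%g.
    split=> [v|k ks].
      have [x' xE] := restrF x; have [y' yE] := restrF y.
      have h : (x * y)%g (jF v) = (y * x)%g (jF v).
        by rewrite !galM_full xE yE yE xE -!galM_full cF.
      by rewrite galM_full h -galM_full mulgV gal_id.
    have h : X k (x * y)%g = X k (y * x)%g %[mod p ^ a k] by rewrite !XM // addnC.
    by rewrite XM // -modnDml h modnDml -XM // mulgV X1.
  have -> : (x * y = (x * y) * (y * x)^-1 * (y * x))%g by rewrite mulgVK.
  by rewrite galM_full Efix.
(* A character of the group of [E] is evaluated on a chosen lift to [Om]; by [sameX] the choice does
   not matter modulo [p ^ a k]. *)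
exists E, iota, (fun k x => X k (e x)); split=> //.
- apply/centsP => x _ y _; apply/eqP/gal_eqP => w _; apply: iEI.
  rewrite !galM_full -!eP -!galM_full; exact: cOm.
- move=> k x y ks; rewrite -XM //; apply: sameX => // w.
  by rewrite galM_full !eP galM_full.
- move=> x xfix Xx; apply/eqP/gal_eqP => w _; apply: iEI.
  rewrite gal_id -eP; apply: Efix; split=> // v.
  by rewrite -iota0P eP -iotaP xfix.
- move=> i; have cL : p \in [pchar (L i)] := pchar_ext (base_emb (L i)) charK.
  have H4 k : exists bl : {poly L i}, lang_solution cL (p ^ a k) (map_poly (base_emb (L i)) (A k)) bl /\
      forall x : gal_of {:L i}, eqX (p ^ a k) (map_poly x bl) (bl * (1 + 'X) ^+ chi k x).
    by have [_ h] := AP k; have [bl] := h i cL; exists bl.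
  have [bl blP] := choice H4.
  apply: (@local_descent Om jF cO A b X E iE i bl cL galOm jFK bP).
  + by move=> k; have [] := blP k.
  + by move=> k; have [] := blP k.
  + by move=> k t n ks; have [_ h] := XP k ks; exact: h.
  + by move=> t x Pt; exact: Efix.
  + by move=> t; exact: Einv.
Qed.

End GlobalExtension.

(** * Abelian p-groups *)

Section AbelianCoordinates.
Local Open Scope group_scope.
Implicit Types gT hT : finGroupType.

(** Coordinates are the exponents along the cyclic factors. Beyond [size b] the modulus is the order
    of 1, so the congruences there are void. *)
Lemma dprod_cycles_coordinates gT (b : seq gT) (G : {group gT}) :
  \big[dprod/1]_(x <- b) <[x]> = G ->
  exists c : nat -> gT -> nat,
    (forall k, {in G &, forall x y, c k (x * y) = (c k x + c k y)%N %[mod #[nth 1 b k]]}) /\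
    {in G, forall x, (forall k, (k < size b)%N -> c k x = 0%N %[mod #[nth 1 b k]]) -> x = 1}.
Proof.
elim: b G => [|g b IH] G.
  rewrite big_nil => defG; exists (fun _ _ => 0%N); split=> // x; rewrite -defG.
  by move=> /set1gP.
rewrite big_cons => defG; have [[_ H _ defH] defM cH tiH] := dprodP defG.
have {IH}[c [cM c0]] := IH H defH; rewrite defH in defM cH tiH.
have dec x : exists nh : nat * gT, x \in G -> nh.2 \in H /\ x = g ^+ nh.1 * nh.2.
  have [|nx] := boolP (x \in G); last by exists (0%N, 1).
  by rewrite -defM => /mulsgP[_ h /cycleP[n ->] hH ->]; exists (n, h).
have [d dP] := choice dec.
have uniq m n h1 h2 : h1 \in H -> h2 \in H -> g ^+ m * h1 = g ^+ n * h2 -> m = n %[mod #[g]] /\ h1 = h2.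
  move=> h1H h2H E.
  have Eh : (g ^+ m)^-1 * g ^+ n = h1 * h2^-1.
    by apply: (mulgI (g ^+ m)); rewrite mulKVg mulgA E mulgK.
  have : (g ^+ m)^-1 * g ^+ n \in <[g]> :&: H.
    rewrite inE; apply/andP; split; first by rewrite groupM ?groupV ?mem_cycle.
    by rewrite Eh groupM ?groupV.
  rewrite tiH => /set1gP e1; split; last first.
    by apply/eqP; rewrite eq_mulgV1 -Eh e1.
  by apply/eqP; rewrite -eq_expg_mod_order eq_mulVg1 e1.
have com h n : h \in H -> commute h (g ^+ n).
  by move=> hH; apply: commuteX; apply: (centP (fintype.subsetP cH h hH)); exact: cycle_id.
exists (fun k x => if k is k'.+1 then c k' (d x).2 else (d x).1); split.
  have dM x y : x \in G -> y \in G -> (d (x * y)).1 = ((d x).1 + (d y).1)%N %[mod #[g]] /\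
      (d (x * y)).2 = (d x).2 * (d y).2.
    move=> xG yG; have [xH xE] := dP x xG; have [yH yE] := dP y yG.
    have [xyH xyE] := dP _ (groupM xG yG); apply: uniq => //; rewrite ?groupM // -xyE [in LHS]xE [in LHS]yE.
    by rewrite expgD -!mulgA; congr (_ * _); rewrite !mulgA (com _ _ xH).
  move=> [|k] x y xG yG /=; have [d1 d2] := dM x y xG yG => //.
  by rewrite d2 cM //; [have [] := dP x xG | have [] := dP y yG].
move=> x xG h; have [xH xE] := dP x xG.
have h1 : (d x).2 = 1 by apply: c0 => // k kb; exact: (h k.+1).
have := h 0%N isT => /= /eqP; rewrite -eq_expg_mod_order expg0 => /eqP h0.
by rewrite xE h1 h0 mulg1.
Qed.

(** The map multiplies the powers [g ^+ c k x] of the generators; directness of the product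
    separates the coordinates of a kernel element. *)
Lemma dprod_cycles_morphism gT hT (b : seq hT) (G : {group gT}) (H : {group hT})
    (c : nat -> gT -> nat) :
  \big[dprod/1]_(x <- b) <[x]> = H ->
  (forall k, {in G &, forall x y, c k (x * y) = (c k x + c k y)%N %[mod #[nth 1 b k]]}) ->
  exists f : {morphism G >-> hT}, f @* G \subset H /\
    {in G, forall x, f x = 1 -> forall k, (k < size b)%N -> c k x = 0%N %[mod #[nth 1 b k]]}.
Proof.
elim: b H c => [|g b IH] H c.
  move=> _ _; have oM : {in G &, {morph (fun=> 1 : hT) : x y / x * y}} by move=> x y _ _; rewrite mulg1.
  exists (Morphism oM); split=> //; apply/fintype.subsetP => _ /morphimP[x _ _ ->]; exact: group1.
rewrite big_cons => defH cM; have [[_ H' _ defH'] defM cH tiH] := dprodP defH.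
have [|f [fH' f0]] := IH H' (fun k => c k.+1) defH'; first by move=> k; exact: (cM k.+1).
rewrite defH' in defM cH tiH.
have fin x : x \in G -> f x \in H' by move=> xG; apply: (fintype.subsetP fH'); exact: mem_morphim.
have com h n : h \in H' -> commute h (g ^+ n).
  by move=> hH; apply: commuteX; apply: (centP (fintype.subsetP cH h hH)); exact: cycle_id.
have eqX m n : m = n %[mod #[g]] -> g ^+ m = g ^+ n.
  by move=> E; apply/eqP; rewrite eq_expg_mod_order; apply/eqP.
have gM : {in G &, {morph (fun x => g ^+ c 0%N x * f x) : x y / x * y}}.
  move=> x y xG yG /=; rewrite (eqX _ _ (cM 0%N x y xG yG)) morphM // expgD -!mulgA.
  by congr (_ * _); rewrite !mulgA (com _ _ (fin x xG)).
exists (Morphism gM); split.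
  apply/fintype.subsetP => _ /morphimP[x _ xG ->] /=; rewrite -defM.
  by apply: mem_mulg; [exact: mem_cycle | exact: fin].
move=> x xG /= E.
have gx : g ^+ c 0%N x \in <[g]> :&: H'.
  rewrite inE mem_cycle /= -(mulgK (f x) (g ^+ _)) E mul1g groupV; exact: fin.
rewrite tiH in gx; move/set1gP: gx => gx.
move=> [|k] kb /=; last by apply: f0 => //; rewrite gx mul1g in E.
by apply/eqP; rewrite -eq_expg_mod_order gx expg0.
Qed.

End AbelianCoordinates.

Section AbelianTypes.
Local Open Scope group_scope.
Implicit Types gT hT : finGroupType.
Variable p : nat.
Hypothesis p_pr : prime p.

(** For an abelian p-group, the exponent of p in its k-th invariant, in decreasing order; the
    default 1 makes it 0 beyond the last invariant. *)
Definition type_log gT (G : {set gT}) k := logn p (nth 1%N (abelian_type G) k).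

(** Taking p^n-th powers respects direct products, and a cyclic factor survives exactly when its
    order exceeds p^n. *)
Lemma p_rank_Mho_cycles gT (b : seq gT) (G : {group gT}) n : p.-group G ->
  \big[dprod/1]_(x <- b) <[x]> = G ->
  'r_p('Mho^n(G)) = count (fun x => n < logn p #[x])%N b.
Proof.
elim: b G => [|g b IH] G pG; first by rewrite big_nil => <-; rewrite Mho1 p_rank1.
rewrite big_cons => defG; have [[_ H _ defH] defM _ _] := dprodP defG.
rewrite defH in defG defM.
have gG : g \in G by have := mem_mulg (cycle_id g) (group1 H); rewrite mulg1 defM.
have pg : p.-elt g := mem_p_elt pG gG.
have HG : H \subset G by rewrite -defM mulG_subr.
rewrite -(p_rank_dprod p (Mho_dprod n defG)) (IH H (pgroupS HG pG) defH) /=; congr (_ + _)%N.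
rewrite (Mho_p_cycle n pg) -(rank_pgroup (_ : p.-group <[g ^+ (p ^ n)]>)); last first.
  by rewrite /pgroup -orderE; exact: p_eltX.
rewrite rank_cycle -order_dvdn; have [e oe] := p_natP pg.
by rewrite oe pfactorK // dvdn_Pexp2l ?prime_gt1 // ltnNge.
Qed.

Lemma sorted_nth_count (s : seq nat) n k : sorted geq s ->
  (n < nth 0%N s k)%N = (k < count (fun x => n < x) s)%N.
Proof.
elim: s k => [|x s IH] k; first by rewrite nth_nil.
move=> /= ps; have ss := path_sorted ps; have [nx|xn] := ltnP n x.
  by case: k => [|k] /=; rewrite ?nx // add1n ltnS IH.
have /allP all_le : all (geq x) s.
  by apply: order_path_min ps => y z t; rewrite /geq /= => h1 h2; exact: leq_trans h2 h1.
have -> : count (fun x => n < x)%N s = 0%N.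
  apply/eqP; rewrite -leqn0 leqNgt -has_count; apply/hasPn => y /all_le.
  by rewrite /= -leqNgt => yx; exact: leq_trans yx xn.
apply/negbTE; rewrite -leqNgt; case: k => [|k] //=.
have [ks|ks] := ltnP k (size s); last by rewrite nth_default.
by apply: leq_trans xn; apply: all_le; exact: mem_nth.
Qed.

Lemma sorted_type_log gT (G : {group gT}) : sorted geq (map (logn p) (abelian_type G)).
Proof.
have := abelian_type_dvdn_sorted G; have := abelian_type_gt1 G.
case: (abelian_type G) => //= x s /andP[x1 s1]; rewrite path_map.
elim: s x x1 s1 => //= y s IH x x1 /andP[y1 s1] /andP[yx ps]; rewrite IH // andbT.
by rewrite /= dvdn_leq_log // ltnW.
Qed.

Lemma type_logE gT (G : {group gT}) k : type_log G k = nth 0%N (map (logn p) (abelian_type G)) k.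
Proof.
rewrite /type_log; have [kG|kG] := ltnP k (size (abelian_type G)).
  by rewrite (nth_map 1%N).
by rewrite !nth_default ?size_map // logn1.
Qed.

(** The ranks of the subgroups of p^n-th powers form the partition conjugate to the exponents.
    Unlike the invariants, these ranks are visibly monotone under embeddings. *)
Lemma type_log_lt gT (G : {group gT}) n k : abelian G -> p.-group G ->
  (n < type_log G k)%N = (k < 'r_p('Mho^n(G)))%N.
Proof.
move=> cG pG; have [b defG ob] := abelian_structure cG.
rewrite (p_rank_Mho_cycles n pG defG) type_logE sorted_nth_count ?sorted_type_log //.
by rewrite -ob !count_map.
Qed.

Lemma type_log_embeds gT hT (G : {group gT}) (H : {group hT}) k :
  abelian G -> p.-group G -> abelian H -> p.-group H -> group_embeds G H ->
  (type_log G k <= type_log H k)%N.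
Proof.
move=> cG pG cH pH [f [injf fH]]; rewrite leqNgt type_log_lt //; apply/negP => h.
have := leq_trans h (_ : 'r_p('Mho^(type_log H k)(G)) <= 'r_p('Mho^(type_log H k)(H)))%N.
rewrite -type_log_lt // ltnn => F; apply: Bool.diff_false_true; apply: F.
rewrite -(injm_p_rank injf (Mho_sub _ _)) morphim_Mho //.
by apply: p_rankS; exact: MhoS.
Qed.

(** The exponents add up to at most [N], and the first [k.+1] of them are each at least the k-th. *)
Lemma type_log_bound gT (G : {group gT}) N k : abelian G -> p.-group G ->
  (#|G| <= p ^ N)%N -> (k.+1 * type_log G k <= N)%N.
Proof.
move=> cG pG lG; have [b defG ob] := abelian_structure cG.
have [e cE] := p_natP pG.
have eN : (e <= N)%N by rewrite cE leq_exp2l ?prime_gt1 in lG.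
apply: leq_trans eN.
have -> : e = (\sum_(t <- map (logn p) (abelian_type G)) t)%N.
  rewrite big_map -ob big_map -(pfactorK e p_pr) -cE -(bigdprod_card defG).
  elim: (b) => [|x b' IH]; first by rewrite !big_nil logn1.
  by rewrite !big_cons lognM ?IH // prodn_gt0 // => y; exact: order_gt0.
rewrite type_logE; have := sorted_type_log G.
elim: (map _ _) k => [|x s IH] k ss; first by rewrite nth_nil muln0.
rewrite big_cons; case: k => [|k]; first by rewrite mul1n leq_addr.
rewrite [nth _ _ _]/= mulSn leq_add //; last by apply: IH; exact: path_sorted ss.
have [ks|ks] := ltnP k (size s); last by rewrite nth_default.
have /allP all_le : all (geq x) s.
  by apply: order_path_min ss => y z t; rewrite /geq /= => h1 h2; exact: leq_trans h2 h1.
by apply: all_le; exact: mem_nth.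
Qed.

Lemma dprod_cycle_pnat gT (b : seq gT) (G : {group gT}) k : \big[dprod/1]_(x <- b) <[x]> = G ->
  p.-group G -> (k < size b)%N -> p.-nat #[nth 1 b k].
Proof.
move=> defG pG kb; apply: pnat_dvd pG; rewrite -(bigdprod_card defG) (big_nth 1) big_mkord.
by rewrite (bigD1 (Ordinal kb)) //= dvdn_mulr.
Qed.

Lemma type_log_order gT (b : seq gT) (G : {group gT}) k : \big[dprod/1]_(x <- b) <[x]> = G ->
  map order b = abelian_type G -> p.-group G -> #[nth 1 b k] = (p ^ type_log G k)%N.
Proof.
move=> defG ob pG; rewrite /type_log -ob; have [kb|kb] := ltnP k (size b).
  rewrite (nth_map 1) //; have /p_natP[e ->] := dprod_cycle_pnat defG pG kb.
  by rewrite pfactorK.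
by rewrite !nth_default ?size_map // order1 logn1.
Qed.

(** This is the previous bound at the last invariant, whose exponent is at least 1. *)
Lemma type_size_bound gT (G : {group gT}) N : abelian G -> p.-group G ->
  (#|G| <= p ^ N)%N -> (size (abelian_type G) <= N)%N.
Proof.
move=> cG pG lG; case E: (size (abelian_type G)) => [//|k].
apply: leq_trans (type_log_bound k cG pG lG); rewrite leq_pmulr //.
have [b defG ob] := abelian_structure cG.
have kb : (k < size (abelian_type G))%N by rewrite E.
have /allP/(_ _ (mem_nth 1%N kb)) /= gt1 := abelian_type_gt1 G.
rewrite /type_log logn_gt0 mem_primes p_pr (ltnW gt1) /=.
have kb' : (k < size b)%N by rewrite -(size_map order) ob.
rewrite -ob (nth_map 1) // in gt1 *.
have /p_natP[[|e] oe] : p.-nat #[nth 1 b k] by exact: dprod_cycle_pnat defG _ kb'.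
  by rewrite oe in gt1.
by rewrite oe expnS dvdn_mulr.
Qed.

(** The k-th coordinate is carried into Z/p^(a k) by multiplication by [p ^ (a k - type_log G k)].
    In this way groups of different types get characters with common moduli. *)
Lemma abelian_characters gT (G : {group gT}) (a : nat -> nat) s : abelian G -> p.-group G ->
  (size (abelian_type G) <= s)%N -> (forall k, (k < s)%N -> (type_log G k <= a k)%N) ->
  exists chi : nat -> gT -> nat,
    (forall k, {in G &, forall x y, chi k (x * y) = (chi k x + chi k y)%N %[mod p ^ a k]}) /\
    {in G, forall x, (forall k, (k < s)%N -> chi k x = 0%N %[mod p ^ a k]) -> x = 1}.
Proof.
move=> cG pG sG ha0; have [b defG ob] := abelian_structure cG.
have ha k : (type_log G k <= a k)%N.
  have [ks|ks] := ltnP k s; first exact: ha0.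
  by rewrite /type_log nth_default ?logn1 // (leq_trans sG ks).
have [c [cM c0]] := dprod_cycles_coordinates defG.
have pa k : (p ^ a k = #[nth 1%g b k] * p ^ (a k - type_log G k))%N.
  by rewrite (type_log_order k defG ob pG) -expnD subnKC.
exists (fun k x => c k x * p ^ (a k - type_log G k))%N; split=> [k x y xG yG|x xG h].
  by rewrite pa -mulnDl -!muln_modl cM.
apply: c0 => // k kb.
have ks : (k < s)%N by apply: leq_trans sG; rewrite -ob size_map.
have := h k ks; rewrite pa -muln_modl !mod0n => /eqP.
by rewrite muln_eq0 expn_eq0 (gtn_eqF (prime_gt0 p_pr)) /= orbF => /eqP.
Qed.

(** Each X k is rescaled into the k-th cyclic factor of [H]. For an index beyond the factors of [H]
    one has [a k = 0], and X k carries no information. *)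
Lemma characters_embed gT hT (G : {group gT}) (H : {group hT}) (a : nat -> nat) s (X : nat -> gT -> nat) :
  abelian H -> p.-group H -> (forall k, (k < s)%N -> (a k <= type_log H k)%N) ->
  (forall k, (k < s)%N -> {in G &, forall x y, X k (x * y) = (X k x + X k y)%N %[mod p ^ a k]}) ->
  {in G, forall x, (forall k, (k < s)%N -> X k x = 0%N %[mod p ^ a k]) -> x = 1} ->
  group_embeds G H.
Proof.
move=> cH pH ha XM Xinj; have [b defH ob] := abelian_structure cH.
pose c k x := if (k < s)%N then (X k x * p ^ (type_log H k - a k))%N else 0%N.
have pa k : (k < s)%N -> (#[nth 1%g b k] = p ^ a k * p ^ (type_log H k - a k))%N.
  by move=> ks; rewrite (type_log_order k defH ob pH) -expnD subnKC // ha.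
have [|f [fH f0]] := @dprod_cycles_morphism _ _ b G H c defH.
  move=> k x y xG yG; rewrite /c; case: ifP => ks; last by rewrite addn0.
  by rewrite pa // -mulnDl -!muln_modl XM.
exists f; split=> //; apply/fintype.subsetP => x kx; apply/set1gP.
have xG := dom_ker kx; apply: Xinj => // k ks.
have [kb|kb] := ltnP k (size b).
  have := f0 x xG (mker kx) k kb; rewrite /c ks pa // -muln_modl !mod0n => /eqP.
  by rewrite muln_eq0 expn_eq0 (gtn_eqF (prime_gt0 p_pr)) /= orbF => /eqP.
have := ha k ks; rewrite /type_log -ob nth_default ?size_map // logn1 leqn0 => /eqP ->.
by rewrite expn0 !modn1.
Qed.

End AbelianTypes.

(** * The harmonic sum and the degree bound *)

Section DegreeBound.
Variable R : realType.

(** The inductive step is ln (1 + x) <= x at x = -1/(n+2). *)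
Lemma harmonic_le n : \sum_(k < n.+1) (k.+1%:R : R)^-1 <= 1 + ln n.+1%:R.
Proof.
elim: n => [|n IH]; first by rewrite big_ord1 invr1 ln1 addr0.
rewrite big_ord_recr /=; apply: le_trans (lerD IH (lexx _)) _.
rewrite -addrA lerD2l -lerBrDl -[ln _ - _]opprK opprB -lerN2 opprK.
have n0 : 0 < n.+2%:R :> R by rewrite ltr0n.
rewrite -ln_div ?posrE ?ltr0n //.
have -> : n.+1%:R / n.+2%:R = 1 + (- n.+2%:R^-1) :> R.
  apply: (mulIf (lt0r_neq0 n0)); rewrite divfK ?lt0r_neq0 // mulrBl mul1r mulVf ?lt0r_neq0 //.
  by rewrite -[n.+2%:R]natr1 addrK.
apply: le_ln1Dx; rewrite ltrN2 invf_lt1 // ltr1n //.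
Qed.

Lemma sum_bound N (a : nat -> nat) : (forall k, (k < N)%N -> (k.+1 * a k <= N)%N) ->
  (\sum_(k < N) a k)%:R <= N%:R * (1 + ln N%:R) :> R.
Proof.
(* For [N = 0] both sides vanish, in accordance with 0 log 0 = 0. *)
case: N => [|N] h; first by rewrite big_ord0 mul0r.
apply: le_trans (ler_wpM2l (ler0n _ _) (harmonic_le N)); rewrite natr_sum mulr_sumr.
apply: ler_sum => k _; rewrite ler_pdivlMr ?ltr0n // -natrM ler_nat mulnC; exact: h.
Qed.

Lemma prime_power_bound p N (a : nat -> nat) : prime p ->
  (forall k, (k < N)%N -> (k.+1 * a k <= N)%N) ->
  (\prod_(k < N) p ^ a k)%:R <= p%:R `^ (N%:R * (1 + ln N%:R)) :> R.
Proof.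
move=> p_pr h; rewrite -expn_sum natrX -powR_mulrn ?ler0n //.
by apply: ler_powR; [rewrite ler1n prime_gt0 | exact: sum_bound].
Qed.

End DegreeBound.

(** * Degrees and generators *)

Section JointCharacters.
Local Open Scope group_scope.
Variables (p s : nat) (a : nat -> nat) (gT : finGroupType) (G : {group gT}) (X : nat -> gT -> nat).
Hypotheses (p_pr : prime p)
  (XM : forall k, (k < s)%N -> {in G &, forall x y, X k (x * y) = (X k x + X k y)%N %[mod p ^ a k]})
  (Xinj : {in G, forall x, (forall k, (k < s)%N -> X k x = 0%N %[mod p ^ a k]) -> x = 1}).

Let X1 k : (k < s)%N -> X k 1 = 0%N %[mod p ^ a k].
Proof.
move=> ks; have := XM ks (group1 G) (group1 G); rewrite mulg1 -{1}[X k 1]addn0 => /eqP.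
by rewrite eqn_modDl => /eqP.
Qed.

Let XX k x n : (k < s)%N -> x \in G -> X k (x ^+ n) = (n * X k x)%N %[mod p ^ a k].
Proof.
move=> ks xG; elim: n => [|n IH]; first by rewrite expg0 mul0n X1.
by rewrite expgS XM ?groupX // -modnDmr IH modnDmr mulSn.
Qed.

Lemma characters_pgroup : p.-group G.
Proof.
rewrite -pnat_exponent; pose M := (\max_(k < s) a k)%N.
apply: (@pnat_dvd _ (p ^ M)); last by rewrite pnatX pnat_id.
apply/exponentP => x xG; apply: Xinj; rewrite ?groupX // => k ks.
have aM : (a k <= M)%N by exact: (@bigop.leq_bigmax _ (fun k : 'I_s => a k) (Ordinal ks)).
by rewrite XX // -(subnKC aM) expnD -mulnA modnMr mod0n.
Qed.

Lemma characters_card : (#|G| <= \prod_(k < s) p ^ a k)%N.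
Proof.
have pos k : (0 < p ^ a k)%N by rewrite expn_gt0 prime_gt0.
pose f (x : gT) : {dffun forall k : 'I_s, 'I_(p ^ a k)} :=
  [ffun k : 'I_s => Ordinal (ltn_pmod (X k x) (pos k))].
have fI : {in G &, injective f}.
  move=> x y xG yG fxy; apply/eqP; rewrite eq_mulgV1; apply/eqP.
  apply: Xinj; first by rewrite groupM ?groupV.
  move=> k ks; have E : X k x = X k y %[mod p ^ a k].
    by have := congr1 (fun h : {dffun forall k : 'I_s, 'I_(p ^ a k)} => val (h (Ordinal ks))) fxy; rewrite !ffunE.
  by rewrite XM ?groupV // -modnDml E modnDml -XM ?groupV // mulgV X1.
rewrite -(card_in_imset fI); apply: leq_trans (max_card _) _.
rewrite card_dep_ffun foldrE big_image /=.
by apply: eq_leq; apply: eq_bigr => k _; rewrite card_ord.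
Qed.

End JointCharacters.

(** The minimal polynomial of [z] over [C], found by descent on remainders, for a field [A] given
    only with a morphism from [C]. *)
Lemma minimal_annihilator (C A : fieldType) (kA : {rmorphism C -> A}) (z : A) (h : {poly C}) :
  h != 0 -> (map_poly kA h).[z] = 0 ->
  exists g : {poly C}, [/\ g != 0, (map_poly kA g).[z] = 0
    & forall P : {poly C}, (map_poly kA P).[z] = 0 -> g %| P].
Proof.
have [n] := ubnP (size h); elim: n h => // n IH h hn h0 hz.
have [H|] := pselect (forall P : {poly C}, (map_poly kA P).[z] = 0 -> h %| P); first by exists h.
move=> /existsNP[P /not_implyP[Pz nP]]; apply: (IH (P %% h)).
- by apply: leq_trans (_ : (size h <= n)%N); rewrite ?ltn_modp.
- by apply/negP => /eqP E; apply: nP; apply/modp_eq0P.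
- have := Pz; rewrite {1}(divp_eq P h) rmorphD rmorphM /= hornerD hornerM hz mulr0 add0r.
  by [].
Qed.

(** The span over [Kw] of finitely many powers of [z] contains the dense image of [E] and is
    complete, so it is everything. *)
Lemma completion_generated (K : fieldType) (E : fieldExtType K) (z : E) (w : place K)
    (Kw : completion w) (v : place E) (Ev : completion v) (c : {rmorphism Kw -> Ev}) (e : nat) :
  (<<1; z>> = {:E})%VS -> (forall x, c (cpl_emb Kw x) = cpl_emb Ev x%:A) -> (0 < e)%N ->
  (forall x, cpl_val Ev (c x) = cpl_val Kw x *+ e) ->
  forall y : Ev, exists P : {poly Kw}, y = (map_poly c P).[cpl_emb Ev z].
Proof.
move=> zgen cK e0 cv y; have [_ Kcpl _] := cpl_isP Kw; have [_ _ dense] := cpl_isP Ev.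
pose zs k := cpl_emb Ev z ^+ k.
have [b ->] : lincomb c zs (\dim {:E}) y.
  apply: (lincomb_dense Kcpl e0 cv) => {}y N; have [x] := dense y N; rewrite vcloseE => hx.
  exists (cpl_emb Ev x) => //; have [P [sP xE]] := adjoin1_full_poly x zgen.
  exists (fun k => cpl_emb Kw P`_k); rewrite xE.
  rewrite (horner_coef_wide _ (_ : (size _ <= \dim {:E})%N)); last by rewrite size_map_poly.
  rewrite rmorph_sum; apply: eq_bigr => k _; rewrite coef_map rmorphM rmorphXn /= cK //.
exists (\poly_(k < \dim {:E}) b k).
rewrite (horner_coef_wide _ (_ : (size _ <= \dim {:E})%N)); last by rewrite size_map_poly size_poly.
by apply: eq_bigr => k _; rewrite coef_map coef_poly ltn_ord.
Qed.

(** An automorphism fixing [psi z] fixes the image of [E], hence is 1; by the Galois correspondence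
    [psi z] generates [L]. *)
Lemma faithful_generates (K : fieldType) (E : splittingFieldType K) (z : E) (C : fieldType)
   (L : splittingFieldType C) (k : {rmorphism K -> C}) (psi : {rmorphism E -> L}) :
  galois 1 {:L} -> (<<1; z>> = {:E})%VS -> (forall x, psi x%:A = (k x)%:A) ->
  (forall t : gal_of {:L}, (forall y, t (psi y) = psi y) -> t = 1%g) ->
  forall y : L, exists P : {poly C}, y = (map_poly (in_alg L) P).[psi z].
Proof.
move=> galL zgen psiK faith y.
suff : y \in <<1; psi z>>%VS.
  move=> yz; have /polyOver1P[P PE] := Fadjoin_polyOver 1 (psi z) y.
  by exists P; rewrite -PE Fadjoin_poly_eq.
have galA : galois <<1; psi z>> {:L} by apply: (galoisS _ galL); rewrite sub1v subvf.
have /galois_fixedField <- := galA.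
apply/fixedFieldP => [|t tA]; first exact: memvf.
rewrite (faith t) ?gal_id // => x; have [P [_ ->]] := adjoin1_full_poly x zgen.
have -> : psi (map_poly (in_alg E) P).[z] = (map_poly (in_alg L) (map_poly k P)).[psi z].
  by rewrite -horner_map /= -!map_poly_comp; congr (_.[_]); apply: eq_map_poly => u /=; exact: psiK.
by rewrite gal_horner (fixed_gal (subvf _) tA) // memv_adjoin.
Qed.

Lemma surj_field_bijective (A B : fieldType) (f : {rmorphism A -> B}) :
  (forall y, exists x, y = f x) -> bijective f.
Proof.
move=> h; have [g gE] := choice h; exists g => x; last by rewrite -gE.
by apply: (fmorph_inj f); rewrite -gE.
Qed.

Section LocalDegree.
Variables (C : fieldType) (F : fieldExtType C) (L : splittingFieldType C) (j : {lrmorphism F -> L}).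
Hypothesis galL : galois 1 {:L}.
Let A : {subfield L} := (linfun j @: {:F})%AS.

Lemma mem_limgP y : reflect (exists x, y = j x) (y \in limg (linfun j)).
Proof.
apply: (iffP memv_imgP) => [[x _ ->]|[x ->]]; first by exists x; rewrite lfunE.
by exists x; rewrite ?memvf ?lfunE.
Qed.

Lemma ext_degree_card : ext_degree j = #|'Gal({:L} / A)%g|.
Proof.
by rewrite -galois_dim //; apply: (galoisS _ galL); rewrite sub1v subvf.
Qed.

(** [p_primary] tests abstract extensions of [F] mapping to [L], whereas [L] is only given over [C].
    The minimal polynomial of a generator of [L] over the image of [F] is pulled back to [F], and
    the field it defines is a test extension of full degree. *)
Lemma primary_ext_degree p : p_primary p j -> exists k, ext_degree j = (p ^ k)%N.
Proof.
move=> prim.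
have galA : galois A {:L} by apply: (galoisS _ galL); rewrite sub1v subvf.
pose z := separable_generator A {:L}.
have zgen : (<<A; z>> = {:L})%VS.
  by have /and3P[s1 s2 _] := galA; rewrite /z -eq_adjoin_separable_generator.
pose g := minPoly A z.
have pull k : exists x, g`_k = j x.
  by apply/mem_limgP; have /polyOverP := minPolyOver A z; apply.
have [x xE] := choice pull.
pose g0 := \poly_(k < size g) x k.
have g0E : map_poly j g0 = g.
  apply/polyP => k; rewrite coef_map coef_poly; case: ltnP => kg /=; first by rewrite -xE.
  by rewrite rmorph0 nth_default.
have sg0 : size g0 = (adjoin_degree A z).+1 by rewrite -(size_map_poly j) g0E size_minPoly.
have irr : irreducible_poly g0.
  split=> [|q q1 qg]; first by rewrite sg0 ltnS adjoin_degreeE divn_gt0 ?adim_gt0 // dimvS // subv_adjoin.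
  have qA : map_poly j q \is a polyOver A.
    by apply/polyOverP => k; rewrite coef_map; apply/mem_limgP; exists q`_k.
  have := minPoly_irr (x := z) qA; rewrite -/g -g0E dvdp_map => /(_ qg)/orP[]; first by rewrite eqp_map.
  by rewrite -size_poly_eq1 size_map_poly (negPf q1).
have [M dM [y y0 ygen]] := irredp_FAdjoin irr.
have minE : map_poly (in_alg M) g0 = minPoly 1 y.
  have gm : g0 \is monic by rewrite -(map_monic j) g0E monic_minPoly.
  apply/esym/eqP; rewrite -eqp_monic ?monic_map ?monic_minPoly //.
  rewrite -dvdp_size_eqp; last by apply: minPoly_dvdp y0; apply/polyOver1P; exists g0.
  by rewrite size_minPoly adjoin_degreeE dimv1 divn1 ygen dM size_map_poly sg0.
have [|f [fK _]] := adjoin1_morphism (kB := j) (zB := z) ygen minE.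
  by rewrite g0E root_minPoly.
have [k dk] := prim M f fK; exists k.
by rewrite -dk dM sg0 /= adjoin_degreeE zgen.
Qed.

End LocalDegree.

(** Over [K] the subextension [L] embeds in [E], so [L:F][F:K] divides [E:K], a power of p. *)
Lemma p_primary_of_degree (p q : nat) (K : fieldType) (F E : fieldExtType K)
    (iota : {lrmorphism F -> E}) : prime p -> \dim {:E} = (p ^ q)%N -> p_primary p iota.
Proof.
move=> p_pr dE L j jF.
have [|g gE] := @alg_lrmorphism K (baseFieldType L) E j.
  move=> x; have iK : iota x%:A = x%:A by rewrite linearZ rmorph1.
  by rewrite -[RHS]iK -[RHS]jF; congr (j _).
have g_ker : lker (linfun g) == 0%VS.
  by apply/lker0P => x y; rewrite !lfunE; exact: fmorph_inj.
have dimL : \dim {:baseFieldType L} = (\dim {:L} * \dim {:F})%N.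
  rewrite -dim_baseVspace; congr (\dim _); apply/vspaceP => x.
  by apply/idP/idP => _; first rewrite mem_baseVspace; exact: memvf.
have dimg : \dim (linfun g @: {:baseFieldType L}) = (\dim {:L} * \dim {:F})%N.
  by rewrite limg_dim_eq ?(eqP g_ker) ?capv0.
have := field_dimS (subvf (linfun g @: {:baseFieldType L})%AS).
rewrite /= dimg dE => dv; have /(dvdn_pfactor _ _ p_pr)[k _ ->] : (\dim {:L} %| p ^ q)%N.
  exact: dvdn_trans (dvdn_mulr _ _) dv.
by exists k.
Qed.

(** * Comparison with the given local extensions *)

Lemma gal_primitive (K : fieldType) (E : splittingFieldType K) (z : E) (s : gal_of {:E}) :
  (<<1; z>> = {:E})%VS -> (<<1; s z>> = {:E})%VS.
Proof.
move=> zgen; apply/vspaceP => x; rewrite memvf.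
have [P [_ PE]] := adjoin1_full_poly (s^-1%g x) zgen.
have -> : x = (map_poly (in_alg E) P).[s z].
  by rewrite -gal_horner -PE -galM_full mulVg gal_id.
apply: mempx_Fadjoin; apply/polyOver1P; by exists P.
Qed.

Section LocalIsomorphism.
Variables (K : fieldType) (F : splittingFieldType K) (w : place K) (v : place F)
  (Kw : completion w) (Fv : completion_over Kw v) (L : splittingFieldType Kw)
  (j : {lrmorphism Fv -> L}).
Hypotheses (galF : galois 1 {:F}) (galL : galois 1 {:L}).

Lemma cplo_emb_alg x : cplo_emb Fv x%:A = (cpl_emb Kw x)%:A.
Proof. by have [h _] := cplo_canonical Fv; exact: esym (h x). Qed.

Lemma cplo_generated zF : (<<1; zF>> = {:F})%VS ->
  forall y : Fv, exists P : {poly Kw}, y = (map_poly (in_alg Fv) P).[cplo_emb Fv zF].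
Proof.
move=> zgen; have [can1 [e [e0 eP]]] := cplo_canonical Fv.
exact: (completion_generated (Ev := cplo_completion Fv) (c := in_alg Fv) zgen can1 e0 eP).
Qed.

Let jK x : j x%:A = x%:A. Proof. by rewrite linearZ rmorph1. Qed.

(** Over [Kw] the minimal polynomial of [z] in [Ev'] divides the one over [K], so it has some
    [psi (s z)] as a root in [L]; the automorphism [s] accounts for the choice of [v']. The
    resulting embedding of [Ev'] in [L] is onto because [s z] is again primitive. *)
Lemma local_isomorphism (E : splittingFieldType K) (iota : {lrmorphism F -> E})
    (psi : {rmorphism E -> L}) (v' : place E) (Ev' : completion v') :
  galois 1 {:E} -> (forall x, psi x%:A = base_emb L x) ->
  (forall z, (<<1; z>> = {:E})%VS -> forall y : L, exists P : {poly Kw}, y = (map_poly (in_alg L) P).[psi z]) ->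
  lies_above iota v v' ->
  exists c : {rmorphism cplo_completion Fv -> Ev'}, is_canonical_map iota c /\
    exists phi : {rmorphism Ev' -> L}, bijective phi /\ forall x, phi (c x) = j x.
Proof.
move=> galE psiK gen [e [e0 eP]].
have [vE Ecpl _] := cpl_isP Ev'.
have [|c [cE cv]] := completion_map (i := [the {rmorphism F -> Ev'} of cpl_emb Ev' \o iota])
  (cplo_isP Fv) Ecpl e0; first by move=> x; rewrite /= vE eP.
have [can1 [e1 [e10 e1P]]] := cplo_canonical Fv.
exists c; split; first by split=> //; exists e.
pose kappa : {rmorphism Kw -> Ev'} := [the {rmorphism Kw -> Ev'} of c \o in_alg Fv].
have kK x : kappa (cpl_emb Kw x) = cpl_emb Ev' x%:A.
  by rewrite /= -cplo_emb_alg cE /= linearZ rmorph1.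
have kv x : cpl_val Ev' (kappa x) = cpl_val Kw x *+ (e1 * e).
  by rewrite /= cv mulrnA; congr (_ *+ _); exact: e1P.
have [z zgen] := galois_primitive galE.
have ee : (0 < e1 * e)%N by rewrite muln_gt0 e10.
have gener := completion_generated zgen kK ee kv.
have [h hm hE] := minPoly1P z.
have h'0 : map_poly (cpl_emb Kw) h != 0 by rewrite map_poly_eq0 monic_neq0.
have h'z : (map_poly kappa (map_poly (cpl_emb Kw) h)).[cpl_emb Ev' z] = 0.
  have -> : map_poly kappa (map_poly (cpl_emb Kw) h) = map_poly (cpl_emb Ev') (map_poly (in_alg E) h).
    by rewrite -!map_poly_comp; apply: eq_map_poly => x; exact: kK.
  by rewrite horner_map /= hE minPolyxx rmorph0.
have [g [g0 gz gdv]] := minimal_annihilator h'0 h'z.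
have [r rE] := galois_splits hE.
have gL : map_poly (in_alg L) g %| \prod_(y <- [seq psi (s z) | s : gal_of {:E} <- r]) ('X - y%:P).
  have -> : \prod_(y <- [seq psi (s z) | s : gal_of {:E} <- r]) ('X - y%:P) =
      map_poly (in_alg L) (map_poly (cpl_emb Kw) h).
    rewrite big_map; transitivity (map_poly psi (map_poly (in_alg E) h)).
      by rewrite rE rmorph_prod; apply: eq_bigr => s _; rewrite /= map_polyXsubC.
    by rewrite -!map_poly_comp; apply: eq_map_poly => x; exact: psiK.
  by rewrite dvdp_map gdv.
have sg : (1 < size g)%N.
  rewrite ltnNge; apply/negP => /size1_polyC gC; move: gz g0; rewrite gC map_polyC hornerC polyC_eq0.
  by move=> /eqP; rewrite fmorph_eq0 => ->.
have [|x rx] := dvdp_split_root gL; first by rewrite size_map_poly.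
have : root (\prod_(y <- [seq psi (s z) | s : gal_of {:E} <- r]) ('X - y%:P)) x.
  by have /dvdpP[q' ->] := gL; rewrite rootM rx orbT.
rewrite root_prod_XsubC => /mapP[s _ xE]; subst x.
have [|phi0 phi0E] := @eval_morphism Kw Ev' L kappa (in_alg L) (cpl_emb Ev' z) (psi (s z)) gener.
  by move=> P /gdv /dvdpP[q ->]; rewrite rmorphM hornerM (rootP rx) mulr0.
have phi0K x : phi0 (kappa x) = x%:A.
  by have := phi0E x%:P; rewrite !map_polyC !hornerC.
have surj0 y : exists x, y = phi0 x.
  have [P ->] := gen _ (gal_primitive s zgen) y; rewrite -phi0E.
  by exists (map_poly kappa P).[cpl_emb Ev' z].
(* [phi0] is so far linear only over [Kw]. The maps [f1] and [j] are two embeddings of [Fv] over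
   [Kw], so an automorphism [t] of [L] makes them agree. *)
have [zF zFgen] := galois_primitive galF; pose zeta := cplo_emb Fv zF.
pose f1 : {rmorphism Fv -> L} := [the {rmorphism Fv -> L} of phi0 \o c].
have f1K x : f1 x%:A = x%:A by exact: phi0K.
have [q _ qE] := minPoly1P (f1 zeta).
have : root (minPoly 1 (f1 zeta)) (j zeta).
  rewrite -qE /root -(alg_horner jK) fmorph_eq0 -(fmorph_eq0 f1) (alg_horner f1K) qE.
  by rewrite minPolyxx.
move=> /(normalField_root_minPoly (sub1v _) (normalFieldf _) (memvf _))[t _ tz].
exists [the {rmorphism Ev' -> L} of t \o phi0]; split.
  apply: surj_field_bijective => y; have [x xE] := surj0 (t^-1%g y).
  by exists x; rewrite /= -xE -galM_full mulVg gal_id.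
move=> x; have [P ->] := cplo_generated zFgen x.
have E1 := alg_horner f1K P zeta; have E2 := alg_horner jK P zeta.
change (t (f1 (map_poly (in_alg Fv) P).[zeta]) = j (map_poly (in_alg Fv) P).[zeta]).
by rewrite E1 gal_horner tz E2.
Qed.

Variables (p m n : nat).
Hypotheses (p_pr : prime p) (dimF : \dim {:F} = (p ^ m)%N) (prim : p_primary p j)
  (degj : (ext_degree j <= p ^ n)%N).

(** Restriction to [F] maps the group to Gal(F/K), of order p^m. The kernel is Gal(L/F_v), because
    [Kw] and [F] generate [Fv]; its order is the degree of [j], a power of p at most p^n. *)
Lemma local_galois_group : (p.-group 'Gal({:L} / 1))%g /\ (#|'Gal({:L} / 1)%g| <= p ^ (n + m))%N.
Proof.
pose G := 'Gal({:L} / 1)%G.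
pose mu : {rmorphism F -> L} := [the {rmorphism F -> L} of j \o cplo_emb Fv].
have muK x : mu x%:A = (cpl_emb Kw x)%:A by rewrite /= cplo_emb_alg jK.
have H (s : gal_of {:L}) : exists t : gal_of {:F}, forall x, s (mu x) = mu (t x).
  have [|t tE] := embeddings_conjugate galF (f := mu) (g := [the {rmorphism F -> L} of s \o mu]).
    by move=> x; rewrite [RHS]/= [mu _]muK [X in s X]muK gal_base.
  by exists t.
have [T TP] := choice H.
have muI x y : mu x = mu y -> x = y by exact: fmorph_inj.
have TM : {in G &, {morph T : x y / (x * y)%g}}.
  move=> x y _ _; apply/eqP/gal_eqP => u _; apply: muI.
  by rewrite -TP !galM_full !TP.
pose f := Morphism TM.
have [zF zFgen] := galois_primitive galF.
pose A : {subfield L} := (linfun j @: {:Fv})%AS.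
have kerE : ('ker f)%g = 'Gal({:L} / A)%g :> {set gal_of {:L}}.
  apply/setP => x; rewrite (gal_kHom _ (subvf _)); apply/idP/kAHomP.
    move=> kx y /mem_limgP[u ->]; have [P ->] := cplo_generated zFgen u.
    rewrite (alg_horner jK) gal_horner; congr (_.[_]).
    by have := TP x zF; have /= -> := mker kx; rewrite gal_id.
  move=> hx; apply/kerP; first exact: mem_gal1.
  apply/eqP/gal_eqP => u _; apply: muI; rewrite gal_id -TP; apply: hx.
  by apply/mem_limgP; exists (cplo_emb Fv u).
have [k degE] := primary_ext_degree galL prim.
have kerC : #|('ker f)%g| = (p ^ k)%N by rewrite kerE -ext_degree_card.
have cardF : #|'Gal({:F} / 1)%g| = (p ^ m)%N by rewrite -galois_dim // dimv1 divn1.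
have /(dvdn_pfactor _ _ p_pr)[l lm lE] : (#|(f @* G)%g| %| p ^ m)%N.
  rewrite -cardF cardSg //; apply/fintype.subsetP => t _; exact: mem_gal1.
have cardG : #|G| = (p ^ (k + l))%N.
  have := Lagrange (normal_sub (ker_normal f)); rewrite kerC => <-.
  by rewrite expnD -lE card_morphim finset.setIid.
have kn : (k <= n)%N by rewrite -(leq_exp2l _ _ (prime_gt1 p_pr)) -degE.
split; first by rewrite /pgroup -/G cardG pnatX pnat_id.
by rewrite -/G cardG leq_exp2l ?prime_gt1 // leq_add.
Qed.

End LocalIsomorphism.

(** Selects one place of [S] above each place of [K] that occurs, so that weak approximation applies
    to distinct places. *)
Lemma finite_representatives (T U : Type) (S : set T) (w : S -> U) : finite_set S ->
  exists (r : nat) (rep : 'I_r -> S), injective (w \o rep) /\ forall v, exists i, w (rep i) = w v.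
Proof.
move=> [n /card_set_bijP[f [fS fI _]]].
have [g gP] : exists g : nat -> option S, forall v : S, g (f (val v)) = Some v.
  exists (fun k => if pselect (exists v : S, f (val v) = k) is left ex then Some (projT1 (cid ex)) else None).
  move=> v; case: pselect => [ex|[]]; last by exists v.
  congr Some; apply: val_inj; apply: fI; rewrite ?inE; try exact: set_valP.
  exact: projT2 (cid ex).
have [vs vsP] : exists vs : seq S, forall v : S, List.In v vs.
  exists (pmap g (iota 0 n)) => v.
  have : f (val v) \in iota 0 n by rewrite mem_iota /= add0n; apply: fS; exact: set_valP.
  elim: (iota 0 n) => //= k l IH; rewrite inE => /orP[/eqP<-|/IH h].
    by rewrite gP /=; left.
  by case: (g k) => //= u; right.
suff [r [rep [repI repP]]] : exists (r : nat) (rep : 'I_r -> S), injective (w \o rep) /\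
    forall v, List.In v vs -> exists i, w (rep i) = w v.
  by exists r, rep; split=> // v; exact: repP.
elim: vs {vsP} => [|v vs [r [rep [repI repP]]]].
  have no : 'I_0 -> S by case.
  by exists 0%N, no; split=> // - [].
have [[i iv]|nv] := pselect (exists i, w (rep i) = w v).
  by exists r, rep; split=> // u [<-|/repP//]; exists i.
pose rep' (i : 'I_r.+1) := if unlift ord0 i is Some k then rep k else v.
exists r.+1, rep'; split=> [i k|u].
  rewrite /= /rep'; case: unliftP => [i' ->|->]; case: unliftP => [k' ->|->] // E.
  - by rewrite (repI _ _ E).
  - by case: nv; exists i'.
  - by case: nv; exists k'.
case=> [<-|/repP[i <-]]; first by exists ord0; rewrite /rep' unlift_none.
by exists (lift ord0 i); rewrite /rep' liftK.
Qed.

Lemma pchar_global_function_field p (K : fieldType) :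
  global_function_field p K -> p \in [pchar K].
Proof.
move=> [k [L [f [chk _]]]].
pose i : {rmorphism k -> {fraction {poly k}}} :=
  [the {rmorphism k -> {fraction {poly k}}} of @tofrac {poly k} \o polyC].
exact: (pchar_ext f (pchar_ext (in_alg L) (pchar_ext i chk))).
Qed.

Lemma ecast_cpl_emb (K : fieldType) (Kc : forall u : place K, completion u)
    (u1 u2 : place K) (e : u1 = u2) x :
  ecast u (Kc u) e (cpl_emb (Kc u1) x) = cpl_emb (Kc u2) x.
Proof. by case: u2 / e. Qed.

Lemma ecast_cpl0 (K : fieldType) (Kc : forall u : place K, completion u)
    (u1 u2 : place K) (e : u1 = u2) : ecast u (Kc u) e 0 = 0 :> Kc u2.
Proof. by case: u2 / e. Qed.

Lemma transport_generated (K : fieldType) (Kc : forall u : place K, completion u)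
    (u1 u2 : place K) (e : u1 = u2) (L1 : fieldExtType (Kc u1)) (L2 : fieldExtType (Kc u2))
    (phi : {rmorphism L1 -> L2}) (z : L1) :
  (forall x : Kc u1, phi x%:A = (ecast u (Kc u) e x)%:A) ->
  forall P : {poly Kc u1}, exists Q : {poly Kc u2},
  phi (map_poly (in_alg L1) P).[z] = (map_poly (in_alg L2) Q).[phi z].
Proof.
move=> phiK P; exists (\poly_(k < size P) ecast u (Kc u) e P`_k).
rewrite -horner_map; congr (_.[_]); apply/polyP => k; rewrite !coef_map coef_poly /=.
by rewrite phiK; case: ltnP => // kP; rewrite nth_default // ecast_cpl0.
Qed.

Section ExtensionDegree.
Variables (K : fieldType) (F E : splittingFieldType K) (iota : {lrmorphism F -> E}).
Let A : {subfield E} := (linfun iota @: {:F})%AS.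

Lemma dim_limg : \dim A = \dim {:F}.
Proof.
rewrite /A /= limg_dim_eq //; have /eqP -> : lker (linfun iota) == 0%VS; last by rewrite capv0.
by apply/lker0P => x y; rewrite !lfunE; exact: fmorph_inj.
Qed.

Lemma dim_ext_degree : \dim {:E} = (ext_degree iota * \dim {:F})%N.
Proof. by rewrite -dim_limg /ext_degree divnK // field_dimS // subvf. Qed.

Lemma gal_limg_fixed (x : gal_of {:E}) y : x \in 'Gal({:E} / A)%g -> x (iota y) = iota y.
Proof. by move=> xA; apply: (fixed_gal (subvf _) xA); apply/mem_limgP; exists y. Qed.

End ExtensionDegree.

(** Lets an arbitrary abelian [H] be replaced by a p-group, to which the comparison of invariants
    applies. *)
Lemma group_embeds_pcore (p : nat) (gT hT : finGroupType) (G : {group gT}) (H : {group hT}) :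
  abelian H -> (p.-group G)%g -> group_embeds G H -> group_embeds G 'O_p(H)%G.
Proof.
move=> cH pG [f [injf fH]]; exists f; split=> //.
apply: pcore_max; first exact: morphim_pgroup.
by rewrite /normal fH cents_norm // (fintype.subset_trans cH) // centS.
Qed.

Theorem theorem2p9 (R : realType) (p m n : nat)
  (K : fieldType) (F : splittingFieldType K)
  (K_global : global_function_field p K)
  (F_abelian : abelian_extension F)
  (F_degree : \dim {:F} = (p ^ m)%N)
  (S : set (place F)) (S_finite : finite_set S)
  (w : S -> place K)
  (w_below : forall v : S, lies_above (in_alg F) (w v) (val v))
  (Kc : forall u : place K, completion u)
  (Fc : forall v : S, completion_over (Kc (w v)) (val v))
  (Ec : forall v : S, splittingFieldType (Kc (w v)))
  (j : forall v : S, {lrmorphism Fc v -> Ec v})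
  (Ec_primary : forall v : S, p_primary p (j v))
  (Ec_degree : forall v : S, (ext_degree (j v) <= p ^ n)%N)
  (Ec_abelian : forall v : S, abelian_extension (Ec v))
  (* Places of S above the same place of K carry K_w-isomorphic extensions;
     the conclusion forces this, E/K being Galois. *)
  (Ec_compatible : forall (v1 v2 : S) (e : w v1 = w v2),
     exists phi : {rmorphism Ec v1 -> Ec v2},
       bijective phi /\
       forall x : Kc (w v1), phi x%:A = (ecast u (Kc u) e x)%:A) :
  exists (E : splittingFieldType K) (iota : {lrmorphism F -> E}),
    [/\ p_primary p iota,
        abelian_extension E,
        (forall (v : S) (v' : place E), lies_above iota (val v) v' ->
         forall Ev' : completion v',
         exists c : {rmorphism cplo_completion (Fc v) -> Ev'},
           is_canonical_map iota c /\
           exists phi : {rmorphism Ev' -> Ec v},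
             bijective phi /\ forall x, phi (c x) = j v x),
        (ext_degree iota)%:R <=
          p%:R `^ ((n + m)%:R * (1 + ln (n + m)%:R)) :> R
      & m = 0%N ->
        forall (hT : finGroupType) (H : {group hT}), abelian H ->
        (forall v : S, group_embeds 'Gal({:Ec v} / 1) H) ->
        group_embeds 'Gal({:E} / 1) H].
Proof.
have charK := pchar_global_function_field K_global.
have p_pr := pcharf_prime charK; have [galF abF] := F_abelian.
have [r [rep [repI repP]]] := finite_representatives w S_finite.
have galL v : galois 1 {:Ec v} := (Ec_abelian v).1.
have abL v : abelian 'Gal({:Ec v} / 1)%g := (Ec_abelian v).2.
have grp v := local_galois_group galF (galL v) p_pr F_degree (Ec_primary v) (Ec_degree v).
pose a k := (\max_(i < r) type_log p 'Gal({:Ec (rep i)} / 1)%g k)%N.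
(* [n + m] characters are enough, since an abelian p-group of order at most p^(n+m) has at most n+m
   invariants. *)
have chars i : exists chi : nat -> gal_of {:Ec (rep i)} -> nat,
    (forall k, {in 'Gal({:Ec (rep i)} / 1)%g &, forall x y, chi k (x * y)%g = chi k x + chi k y %[mod p ^ a k]}) /\
    {in 'Gal({:Ec (rep i)} / 1)%g, forall x, (forall k, (k < n + m)%N -> chi k x = 0 %[mod p ^ a k]) -> x = 1%g}.
  have [pG cG] := grp (rep i); apply: abelian_characters => //.
    exact: type_size_bound cG.
  by move=> k _; exact: (@bigop.leq_bigmax _ (fun i : 'I_r => type_log p 'Gal({:Ec (rep i)} / 1)%g k) i).
pose chi i := projT1 (cid (chars i)); have chiP i := projT2 (cid (chars i)).
pose mu i : {rmorphism F -> Ec (rep i)} :=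
  [the {rmorphism F -> Ec (rep i)} of j (rep i) \o cplo_emb (Fc (rep i))].
have [||i x|E [iota [X [galE abE XM Xinj locE]]]] :=
  @global_extension p K F (n + m) a r (w \o rep) (fun i => Kc (w (rep i))) (fun i => Ec (rep i))
    chi mu charK galF abF repI (fun i => galL (rep i)).
- by move=> i k x y; have [h _] := chiP i; apply: h; exact: mem_gal1.
- by move=> i x h; have [_ inj] := chiP i; apply: inj => //; exact: mem_gal1.
- by rewrite /= cplo_emb_alg linearZ rmorph1.
exists E, iota.
pose J := 'Gal({:E} / (linfun iota @: {:F})%AS)%G.
have XMJ k : (k < n + m)%N -> {in J &, forall x y, X k (x * y)%g = X k x + X k y %[mod p ^ a k]}.
  by move=> ks x y _ _; exact: XM.
have XinjJ : {in J, forall x, (forall k, (k < n + m)%N -> X k x = 0 %[mod p ^ a k]) -> x = 1%g}.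
  by move=> x xJ; apply: Xinj => y; exact: gal_limg_fixed xJ.
have degE : ext_degree iota = #|J| := ext_degree_card iota galE.
have /p_natP[q Jq] : (p.-group J)%g := characters_pgroup p_pr XMJ XinjJ.
split.
- by apply: (@p_primary_of_degree p (q + m)) => //; rewrite (dim_ext_degree iota) degE Jq F_degree expnD.
- by [].
(* The embedding of [E] was built for the representative [rep i]; it is carried to [Ec v] by the
   compatibility isomorphism, which also moves the coefficients of the generating polynomials. *)
- move=> v v' above Ev'; have [i iv] := repP v.
  have [psi0 [psi0K faith]] := locE i; have [phi [phib phiK]] := Ec_compatible _ _ iv.
  pose psi := [the {rmorphism E -> Ec v} of phi \o psi0].
  have psiK x : psi x%:A = base_emb (Ec v) x by rewrite /= psi0K /= phiK ecast_cpl_emb.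
  have gen z : (<<1; z>> = {:E})%VS ->
      forall y : Ec v, exists P : {poly Kc (w v)}, y = (map_poly (in_alg (Ec v)) P).[psi z].
    move=> zgen y; have [phi' phiK1 phiK2] := phib.
    have [P PE] := faithful_generates (galL (rep i)) zgen psi0K faith (phi' y).
    have [Q QE] := transport_generated (psi0 z) phiK P.
    by exists Q; rewrite -QE -PE phiK2.
  apply: (local_isomorphism (j v) galF _ galE psiK gen above).
- rewrite degE; apply: le_trans (prime_power_bound R (N := n + m) (a := a) p_pr _).
    by rewrite ler_nat; exact: characters_card XMJ XinjJ.
  move=> k ks; rewrite mulnC -leq_divRL //; apply/bigop.bigmax_leqP => i _.
  have [pG cG] := grp (rep i); rewrite leq_divRL // mulnC; exact: type_log_bound cG.
- move=> m0 hT H cH embH.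
  (* Here F = K, so every automorphism of [E] fixes the image of [F] and the characters are jointly
     injective on the whole group. *)
  have fixF x y : (x : gal_of {:E}) (iota y) = iota y.
    have : y \in (1%VS : {vspace F}).
      suff -> : (1%VS : {vspace F}) = {:F}%VS by exact: memvf.
      by apply/eqP; rewrite eqEdim subvf dimv1 F_degree m0.
    by case/vlineP => c ->; rewrite linearZ rmorph1 gal_base.
  have [//|//|k ks|k ks x y _ _|x _|f [injf fO]] :=
    @characters_embed p p_pr _ _ 'Gal({:E} / 1)%G 'O_p(H)%G a (n + m) X.
  + exact: abelianS (pcore_sub _ _) cH.
  + exact: pcore_pgroup.
  + apply/bigop.bigmax_leqP => i _; apply: type_log_embeds => //.
    * by have [] := grp (rep i).
    * exact: abelianS (pcore_sub _ _) cH.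
    * exact: pcore_pgroup.
    * by apply: group_embeds_pcore => //; have [] := grp (rep i).
  + exact: XM.
  + exact: Xinj.
  + by exists f; split=> //; apply: fintype.subset_trans fO (pcore_sub _ _).
Qed.
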